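(* Let $P_1,P_2,P_3\in\mathbb{R}^2$ be three non-aligned points. The following are equivalent: (i) the set of points $Q\in\mathbb{R}^2$ such that $d(Q,P_1),d(Q,P_2),d(Q,P_3)$ are all rational numbers is dense in $\mathbb{R}^2$ (for the real topology); (ii) the quadratic form $(x,y)\mapsto \|x\,\overrightarrow{P_1P_3}+y\,\overrightarrow{P_2P_3}\|^2$ has rational coefficients and represents a square, i.e. there exist $x,y\in\mathbb{Q}$, not both zero, such that $\|x\,\overrightarrow{P_1P_3}+y\,\overrightarrow{P_2P_3}\|^2$ is the square of a rational number; (iii) the squared distances $d(P_i,P_j)^2$, $i,j\in\{1,2,3\}$, are all rational, and there exists at least one point $Q\in\mathbb{R}^2$ having rational distance from each of $P_1,P_2,P_3$.
   Context: $d(P,Q)$ denotes the Euclidean distance in $\mathbb{R}^2$ and $\|\cdot\|$ the Euclidean norm. ''Non-aligned'' means not lying on a common line. *)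

(* Defs.v *)
From mathcomp Require Export all_boot all_order all_algebra.
From mathcomp Require Export mathcomp_extra boolp classical_sets reals topology.
From mathcomp Require Export normedtype.
#[export] Set Implicit Arguments.
#[export] Unset Strict Implicit.
#[export] Unset Printing Implicit Defensive.
Export Order.TTheory GRing.Theory Num.Theory numFieldNormedType.Exports.
Global Open Scope classical_set_scope.
Global Open Scope ring_scope.

(* The library norm `|v| on row vectors is the sup norm, so the Euclidean norm
   is defined here. The library topology on 'rV[R]_n is the product topology,
   which is the usual topology of R^n. *)
Definition enorm (R : realType) (n : nat) (v : 'rV[R]_n) : R :=
  Num.sqrt (\sum_(i < n) v 0 i ^+ 2).

Definition edist (R : realType) (n : nat) (A B : 'rV[R]_n) : R :=
  enorm (B - A).

Definition aligned (R : realType) (n : nat) (A B C : 'rV[R]_n) : Prop :=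
  exists (O u : 'rV[R]_n), u != 0 /\
    forall M, M \in [:: A; B; C] -> exists t : R, M = O + t *: u.

Definition rational_coefficients (R : realType) (q : R -> R -> R) : Prop :=
  exists a b c : rat, forall x y : R,
    q x y = ratr a * x ^+ 2 + ratr b * (x * y) + ratr c * y ^+ 2.

Definition represents_square (R : realType) (q : R -> R -> R) : Prop :=
  exists x y : rat, (x, y) != (0, 0) /\
    exists r : rat, q (ratr x) (ratr y) = ratr r ^+ 2.

(* Main.v *)
(** Put a = P1 - P3 and b = P2 - P3.

    (i) => (iii): with X, u, v the differences |QP3|^2, |QP3|^2 - |QP1|^2 and
    |QP3|^2 - |QP2|^2, X is a quadratic polynomial in the coordinates (u, v) of
    the plane. As (X, u, v) is rational on a dense set, this polynomial has
    rational coefficients, and these determine the Gram matrix of a and b.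

    (iii) => (ii): a point at rational distances has rational coordinates in the
    basis (a, b).

    (ii) => (i): a rational combination of a and b of rational length gives an
    orthogonal basis in which all three points have rational coordinates and the
    squared norm is x^2 + D y^2 with D rational. The directions
    (1 - D t^2, 2 t), t rational, are dense and have rational length. On the
    line through P3 with such a direction, the points at rational distances from
    P1 and P2 form an elliptic curve, isomorphic to
    y^2 = x (x^2 + M x + N) with M, N > 0. Three facts about this curve suffice:
    - if it has sufficiently many rational points with x > 0, these are dense
      in that component: two close points differ by a small point, whose
      multiples sweep the component in small steps;
    - it carries a rational point depending algebraically on t, and the
      iterated doubles of this point are distinct rational functions of t: at a
      real t0 for which the line is parallel to P1P2, the point tends to the
      origin of the group, and its k-th double has x-coordinate asymptotically
      4^-k times the original one; hence for all but finitely many t any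
      prescribed number of these doubles are distinct;
    - the point of the plane attached to (t, x) varies continuously. *)
Require Import Defs.
From mathcomp Require Import ring lra realfun.

(** * The group law on y^2 = x (x^2 + M x + N) *)

(* The variable v stands for y / x. *)
Definition curve_point (F : numFieldType) (M N x : F) : Prop :=
  0 < x /\ exists2 v : F, 0 < v & v ^+ 2 = x + M + N / x.

Lemma curve_point_norm (F : realFieldType) (M N x v : F) :
  0 < M -> 0 < N -> 0 < x -> v ^+ 2 = x + M + N / x -> curve_point M N x.
Proof.
move=> M0 N0 x0 hv; split=> //; exists `|v|; last by rewrite real_normK ?num_real.
rewrite normr_gt0; apply/eqP => v0; move: hv; rewrite v0 expr0n /= => hv.
have := divr_gt0 N0 x0; lra.
Qed.

(* Translation by the point (0, 0) of order 2. *)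
Lemma curve_point_inv (F : realFieldType) (M N x : F) :
  0 < N -> curve_point M N x -> curve_point M N (N / x).
Proof.
move=> N0 [x0 [v v0 hv]]; split; first exact: divr_gt0.
exists v => //; rewrite hv; field; lra.
Qed.

(* [z] is the x-coordinate of the difference, written so that it is visibly
   large when [x] and [y] are close. *)
Lemma curve_point_sub (F : realFieldType) (M N x y : F) :
  0 < M -> 0 < N -> curve_point M N x -> curve_point M N y -> x != y ->
  exists2 z, x * y * (x + y) / (x - y) ^+ 2 <= z & curve_point M N z.
Proof.
move=> M0 N0 [x0 [v v0 hv]] [y0 [w w0 hw]] xy.
have d0 : x - y != 0 by rewrite subr_eq0.
have d2 : 0 < (x - y) ^+ 2 by rewrite exprn_even_gt0.
have s0 : v + w != 0 by lra.
exists (x * y * (v + w) ^+ 2 / (x - y) ^+ 2).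
  rewrite ler_pM2r ?invr_gt0// ler_pM2l ?mulr_gt0//.
  have := divr_gt0 N0 x0; have := divr_gt0 N0 y0; have := mulr_gt0 v0 w0.
  rewrite sqrrD hv hw; lra.
apply: (@curve_point_norm _ _ _ _ ((x * v + y * w) / (x - y) - (x - y) / (v + w))) => //.
  by apply: divr_gt0 => //; apply: mulr_gt0; rewrite ?mulr_gt0 ?exprn_gt0 ?addr_gt0.
have eM : M = v ^+ 2 - x - N / x by lra.
have eN : N = x * y * (v ^+ 2 - w ^+ 2 - x + y) / (y - x).
  rewrite hv hw; field; lra.
rewrite eM eN; field; lra.
Qed.

(* This form of the sum, unlike the chord formula, also covers [x = y]. *)
Lemma curve_point_add (F : realFieldType) (M N x y : F) (v w : F) :
  0 < M -> 0 < N -> 0 < x -> 0 < y -> 0 < v -> 0 < w -> x * y != N ->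
  v ^+ 2 = x + M + N / x -> w ^+ 2 = y + M + N / y ->
  curve_point M N ((x * y - N) ^+ 2 / (x * y * (v + w) ^+ 2)).
Proof.
move=> M0 N0 x0 y0 v0 w0 Nxy hv hw.
have s0 : v + w != 0 by lra.
have p0 : x * y - N != 0 by rewrite subr_eq0.
apply: (@curve_point_norm _ _ _ _
  ((x + y + M + v * w) / (v + w) - x * y * (v + w) / (x * y - N))) => //.
  apply: divr_gt0; first by rewrite exprn_even_gt0.
  by apply: mulr_gt0; rewrite ?mulr_gt0 ?exprn_gt0 ?addr_gt0.
have eM : M = v ^+ 2 - x - N / x by lra.
have [exy|nxy] := eqVneq x y.
  have evw : v = w.
    by apply/eqP; rewrite -(@eqrXn2 _ 2) ?ltW// hv hw exy.
  rewrite eM; subst y w; field; lra.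
have eN : N = x * y * (v ^+ 2 - w ^+ 2 - x + y) / (y - x).
  rewrite hv hw; field; lra.
have d0 : y - x != 0 by lra.
rewrite eM eN; field.
rewrite s0 d0 (lt0r_neq0 x0) (lt0r_neq0 y0)/=.
have -> : x * y * (y - x) - x * y * (v ^+ 2 - w ^+ 2 - x + y) = (x * y - N) * (y - x).
  by rewrite eN; field.
by rewrite mulf_eq0 negb_or p0 d0.
Qed.

Lemma curve_point_add_bounds (F : realFieldType) (x1 x2 M1 N1 : F) :
  0 < x1 < x2 -> 0 < M1 -> 0 < N1 ->
  exists L : F, forall M N x y : F, 0 < M <= M1 -> 0 < N <= N1 -> x2 <= x -> L <= y ->
    curve_point M N x -> curve_point M N y ->
    exists z : F, [/\ curve_point M N z, x1 < z & z <= x - x2 ^+ 2 / (x2 + y)].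
Proof.
move=> /andP[x10 x12] M10 N10.
have x20 : 0 < x2 by lra.
have e0 : 0 < x2 - x1 by lra.
pose C := M1 + N1 / x2.
pose m := (x1 + x2) / 2.
pose k := x1 + 2 * x1 ^+ 2 / (x2 - x1).
pose L1 := (k * x2 + (m + k) * C + 2 * N1) / (x2 - m).
have C0 : 0 < C by rewrite addr_gt0// divr_gt0.
have k0 : 0 < k by rewrite addr_gt0// divr_gt0// mulr_gt0// exprn_gt0.
have m0 : 0 < m by rewrite /m; lra.
have mx2 : 0 < x2 - m by rewrite /m; lra.
exists (x2 + k + L1 + N1 / x2) => M N x y /andP[M0 hM] /andP[N0 hN] hx hy.
move=> [x0 [v v0 hv]] [y0 [w w0 hw]].
have L10 : 0 < L1.
  by rewrite divr_gt0// !addr_gt0// !mulr_gt0// addr_gt0.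
have N2 : 0 < N1 / x2 by rewrite divr_gt0.
have yN : N1 / x2 < y by lra.
have xy0 : 0 < x * y by rewrite mulr_gt0.
have Nxy : N < x * y.
  have : N1 < x2 * y by rewrite mulrC -ltr_pdivrMr.
  have : x2 * y <= x * y by rewrite ler_pM2r.
  lra.
have hNx z : x2 <= z -> N / z <= N1 / x2.
  move=> hz; rewrite ler_pdivrMr; last lra.
  rewrite -mulrAC ler_pdivlMr//.
  apply: ler_pM; lra.
exists ((x * y - N) ^+ 2 / (x * y * (v + w) ^+ 2)).
have s20 : 0 < (v + w) ^+ 2 by rewrite exprn_gt0// addr_gt0.
have xys0 : 0 < x * y * (v + w) ^+ 2 by exact: mulr_gt0.
split.
- by apply: curve_point_add; rewrite ?gt_eqF.
- rewrite ltr_pdivlMr//.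
  have hv1 : v ^+ 2 <= x + C by have := hNx x hx; rewrite hv /C; lra.
  have hw1 : w ^+ 2 <= y + C by have := hNx y; rewrite hw /C; lra.
  have hs : x1 * (v + w) ^+ 2 <= m * w ^+ 2 + k * v ^+ 2.
    rewrite -subr_ge0.
    have -> : m * w ^+ 2 + k * v ^+ 2 - x1 * (v + w) ^+ 2 =
      ((x2 - x1) * w - 2 * x1 * v) ^+ 2 / (2 * (x2 - x1)).
      rewrite /m /k; field; lra.
    by rewrite divr_ge0 ?sqr_ge0// mulr_ge0// ltW.
  have hs2 : x1 * (v + w) ^+ 2 <= m * (y + C) + k * (x + C).
    apply: (le_trans hs); apply: lerD; rewrite ler_pM2l//.
  have hL : L1 * (x2 - m) = k * x2 + (m + k) * C + 2 * N1.
    by rewrite /L1; field; lra.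
  have h1 : m * (y + C) + k * (x + C) < x * y - 2 * N.
    have t1 : 0 < (y - L1) * (x2 - m) by apply: mulr_gt0; lra.
    have t2 : 0 <= (x - x2) * (y - k) by apply: mulr_ge0; lra.
    nra.
  have : x * y * (x1 * (v + w) ^+ 2) < x * y * (x * y - 2 * N).
    by rewrite ltr_pM2l//; apply: le_lt_trans h1.
  have := sqr_ge0 N; nra.
- have hNN : (x * y - N) ^+ 2 <= (x * y) ^+ 2.
    by rewrite ler_sqr ?nnegrE; lra.
  have hs3 : x2 + y <= (v + w) ^+ 2.
    rewrite sqrrD hv hw.
    have := divr_gt0 N0 x0; have := divr_gt0 N0 y0; have := mulr_gt0 v0 w0.
    lra.
  have x2y0 : 0 < x2 + y by lra.
  have -> : x - x2 ^+ 2 / (x2 + y) = (x * (x2 + y) - x2 ^+ 2) / (x2 + y).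
    by field; lra.
  apply: (@le_trans _ _ (x * y / (x2 + y))); last first.
    rewrite ler_pM2r ?invr_gt0//; nra.
  rewrite ler_pdivrMr//.
  apply: (le_trans hNN).
  have -> : x * y / (x2 + y) * (x * y * (v + w) ^+ 2) =
      (x * y) ^+ 2 * ((v + w) ^+ 2 / (x2 + y)) by field; lra.
  by rewrite ler_peMr ?sqr_ge0// ler_pdivlMr ?mul1r.
Qed.

Lemma descent_hits (F : archiRealFieldType) (P : F -> Prop) (x1 x2 d x : F) :
  0 < d -> P x -> x1 < x ->
  (forall y, P y -> x2 <= y -> exists z, [/\ P z, x1 < z & z <= y - d]) ->
  exists2 z, P z & x1 < z < x2.
Proof.
move=> d0 Px x1x step.
have [n hn] : exists n, x <= x1 + n%:R * d.
  exists (Num.bound ((x - x1) / d)); rewrite -lerBlDl -ler_pdivrMr//.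
  by rewrite ltW// archi_boundP// divr_ge0 ?subr_ge0 ?ltW.
elim: n x Px x1x hn => [|n IH] x Px x1x hn; first by lra.
have [xx2|xx2] := ltP x x2; first by exists x; rewrite ?x1x.
have [z [Pz x1z hz]] := step _ Px xx2.
by apply: (IH z Pz x1z); move: hn; rewrite -natr1 mulrDl; lra.
Qed.

Lemma pigeonhole_close (F : archiRealFieldType) (J : nat) (L : F)
    (f : 'I_J.+1 -> F) :
  (0 < J)%N -> 0 < L -> (forall i, 0 < f i < L) ->
  exists i j, i != j /\ (f i - f j) ^+ 2 <= (L / J%:R) ^+ 2.
Proof.
move=> J0 L0 hf.
have JR : 0 < J%:R :> F by rewrite ltr0n.
pose g i := f i * J%:R / L.
have g0 i : 0 <= g i.
  by have /andP[f0 _] := hf i; rewrite divr_ge0 ?mulr_ge0// ltW.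
have gJ i : (Num.truncn (g i) < J)%N.
  rewrite truncn_lt_nat// ltr_pdivrMr// mulrC ltr_pM2l//.
  by have /andP[] := hf i.
pose h i := Ordinal (gJ i).
have /injectivePn[i [j ij hij]] : ~~ injectiveb h.
  by apply/negP => /injectiveP /leq_card; rewrite !card_ord ltnn.
exists i, j; split=> //.
have e : Num.truncn (g i) = Num.truncn (g j) by have := congr1 val hij.
have /andP[gi1 gi2] := truncn_itv (g0 i).
have /andP[gj1 gj2] := truncn_itv (g0 j).
rewrite e -natr1 in gi1 gi2; rewrite -natr1 in gj2.
have -> : f i - f j = (g i - g j) * (L / J%:R).
  by rewrite /g; field; lra.
rewrite exprMn ler_piMl ?sqr_ge0//.
have : 0 <= (1 - (g i - g j)) * (1 + (g i - g j)) by apply: mulr_ge0; lra.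
lra.
Qed.

Lemma curve_points_dense (F : archiRealFieldType) (x1 x2 M1 N0 N1 : F) :
  0 < x1 < x2 -> 0 < M1 -> 0 < N0 -> 0 < N1 ->
  exists J, forall (M N : F) (f : 'I_J.+1 -> F),
    0 < M <= M1 -> N0 <= N <= N1 -> (forall i, curve_point M N (f i)) ->
    injective f -> exists2 x, curve_point M N x & x1 < x < x2.
Proof.
move=> x12 M10 N00 N10.
have [x10 _] := andP x12.
have [L hL] := curve_point_add_bounds x12 M10 N10.
pose K := Num.max L (x1 + 1).
have K0 : 0 < K by rewrite lt_max; apply/orP; right; lra.
pose r := K ^+ 3 / (N0 / K) ^+ 3.
have lo0 : 0 < N0 / K by exact: divr_gt0.
have r0 : 0 < r by rewrite divr_gt0// exprn_gt0.
pose J := Num.bound r.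
have rJ : r < J%:R by apply: archi_boundP; exact: ltW.
exists J => M N f hM hN hf finj.
have [M0 _] := andP hM.
have N0' : 0 < N by lra.
have hN' : 0 < N <= N1 by lra.
suff [y hy Ky] : exists2 y, curve_point M N y & K <= y.
  have Ly : L <= y by apply: le_trans Ky; rewrite le_max lexx.
  have x1y : x1 < y.
    by apply: (@lt_le_trans _ _ (x1 + 1)); [lra|apply: le_trans Ky; rewrite le_max lexx orbT].
  have y0 : 0 < y by lra.
  have x20 : 0 < x2 by lra.
  apply: (@descent_hits _ _ x1 x2 (x2 ^+ 2 / (x2 + y)) y) => //.
    by rewrite divr_gt0 ?exprn_gt0 ?addr_gt0.
  by move=> x hx x2x; apply: hL => //.
have [[i hi]|/forallNP big] := pselect (exists i, K <= f i); first by exists (f i).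
have [[i hi]|/forallNP small] := pselect (exists i, f i <= N0 / K).
  exists (N / f i); first exact: curve_point_inv.
  have [f0 _] := hf i.
  rewrite ler_pdivlMr// mulrC -ler_pdivlMr//; apply: (le_trans hi).
  by rewrite ler_pM2r ?invr_gt0//; lra.
have J0 : (0 < J)%N by rewrite -(ltr0n F); lra.
have fK i : 0 < f i < K by have [-> _] := hf i; rewrite /= ltNge; exact/negP.
have [i [j [ij hij]]] := pigeonhole_close J0 K0 fK.
have fij : f i != f j by apply: contra ij => /eqP/finj ->.
have [z hz cz] := curve_point_sub M0 N0' (hf i) (hf j) fij.
exists z => //; apply: le_trans hz.
have lo_lt k : N0 / K < f k by rewrite ltNge; exact/negP.
have d0 : 0 < (f i - f j) ^+ 2 by rewrite exprn_even_gt0 //= subr_eq0.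
rewrite ler_pdivlMr//.
have JR : 0 < J%:R :> F by rewrite ltr0n.
apply: (@le_trans _ _ (K * (K / J%:R) ^+ 2)); first by rewrite ler_pM2l.
have -> : K * (K / J%:R) ^+ 2 = K ^+ 3 / (J%:R ^+ 2) by field; lra.
have hK : K ^+ 3 <= (N0 / K) ^+ 3 * J%:R.
  by rewrite mulrC -ler_pdivrMr ?exprn_gt0// ltW.
have J1 : J%:R <= J%:R ^+ 2 :> F by rewrite -natrX ler_nat -{1}(expn1 J) leq_pexp2l.
rewrite ler_pdivrMr ?exprn_gt0//.
apply: (le_trans hK); apply: ler_pM => //; first by rewrite exprn_ge0// ltW.
set l := N0 / K in lo_lt lo0 *.
have l2 : l ^+ 2 < f i * f j by rewrite expr2 ltr_pM// ltW.
have -> : l ^+ 3 = l ^+ 2 * l by ring.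
apply: ltW; rewrite ltr_pM ?exprn_ge0 ?(ltW lo0)//; have := lo_lt i; have := lo_lt j; lra.
Qed.

(** * Iterated doubling *)

(* Duplication of a point whose x-coordinate is the fraction nd.1 / nd.2. *)
Definition dbl (T : comNzRingType) (M N : T) (nd : T * T) : T * T :=
  ((nd.1 ^+ 2 - N * nd.2 ^+ 2) ^+ 2,
   4 * nd.1 * nd.2 * (nd.1 ^+ 2 + M * nd.1 * nd.2 + N * nd.2 ^+ 2)).

Lemma rmorph_dbl (T U : comNzRingType) (f : {rmorphism T -> U}) (M N : T)
    (nd : T * T) :
  dbl (f M) (f N) (f nd.1, f nd.2) = (f (dbl M N nd).1, f (dbl M N nd).2).
Proof.
by rewrite /dbl /= !(rmorphM, rmorphXn, rmorphB, rmorphD, rmorph_nat).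
Qed.

Lemma rmorph_iter_dbl (T U : comNzRingType) (f : {rmorphism T -> U}) (M N : T)
    (nd : T * T) (k : nat) :
  iter k (dbl (f M) (f N)) (f nd.1, f nd.2) =
  (f (iter k (dbl M N) nd).1, f (iter k (dbl M N) nd).2).
Proof. by elim: k => //= k ->; rewrite rmorph_dbl. Qed.

(* [f] is evaluation at a point where [v] vanishes: the pole of the fraction is
   kept, and the ratio of its leading coefficients is multiplied by 4. *)
Lemma iter_dbl_pole (T : comNzRingType) (F : numFieldType)
    (f : {rmorphism T -> F}) (M N n d v : T) (k : nat) :
  f v = 0 -> f n != 0 -> f d != 0 ->
  let nd := iter k (dbl M N) (n, v ^+ 2 * d) in
  f nd.1 != 0 /\
  exists2 e, nd.2 = v ^+ 2 * e & f e = 4 ^+ k * (f d / f n) * f nd.1.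
Proof.
move=> fv fn fd /=; elim: k => [|k [IHn [e IHe fe]]].
  by split=> //=; exists d => //; rewrite mul1r divfK.
rewrite /=; case: (iter k _ _) IHn IHe fe => a b /= fa eb fe.
have fb : f b = 0 by rewrite eb rmorphM rmorphXn fv expr0n mul0r.
have fn1 : f ((a ^+ 2 - N * b ^+ 2) ^+ 2) = f a ^+ 4.
  by rewrite !(rmorphXn, rmorphB, rmorphM) fb; ring.
rewrite fn1; split; first by rewrite expf_neq0.
exists (4 * a * e * (a ^+ 2 + M * a * b + N * b ^+ 2)); first by rewrite eb; ring.
rewrite !(rmorphM, rmorphXn, rmorphD, rmorph_nat) fb fe (exprS _ k); ring.
Qed.

Lemma iter_dbl_distinct (T : idomainType) (F : numFieldType)
    (f : {rmorphism T -> F}) (M N n d v : T) (i j : nat) :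
  v != 0 -> f v = 0 -> f n != 0 -> f d != 0 -> i != j ->
  let nd k := iter k (dbl M N) (n, v ^+ 2 * d) in
  (nd i).1 * (nd j).2 - (nd j).1 * (nd i).2 != 0.
Proof.
move=> v0 fv fn fd ij /=.
have [ni [ei -> fei]] := iter_dbl_pole M N i fv fn fd.
have [nj [ej -> fej]] := iter_dbl_pole M N j fv fn fd.
set a := (iter i _ _).1 in ni fei *; set b := (iter j _ _).1 in nj fej *.
have -> : a * (v ^+ 2 * ej) - b * (v ^+ 2 * ei) = v ^+ 2 * (a * ej - b * ei).
  by ring.
rewrite mulf_neq0 ?expf_neq0//.
apply/eqP => /(congr1 f); rewrite rmorph0 rmorphB !rmorphM fei fej.
have -> : f a * (4 ^+ j * (f d / f n) * f b) - f b * (4 ^+ i * (f d / f n) * f a)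
  = (4 ^+ j - 4 ^+ i) * (f a * f b * (f d / f n)) by ring.
apply/eqP; rewrite mulf_neq0 ?mulf_neq0 ?invr_eq0// subr_eq0.
by rewrite -!natrX eqr_nat eqn_exp2l// eq_sym.
Qed.

Lemma curve_point_iter_dbl (F : realFieldType) (M N : F) (nd : F * F) (k : nat) :
  0 < M -> 0 < N -> 0 < nd.1 -> 0 < nd.2 -> curve_point M N (nd.1 / nd.2) ->
  (forall i, (i <= k)%N -> (iter i (dbl M N) nd).1 != 0) ->
  let nd' := iter k (dbl M N) nd in
  [/\ 0 < nd'.1, 0 < nd'.2 & curve_point M N (nd'.1 / nd'.2)].
Proof.
move=> M0 N0 n0 d0 c0; elim: k => [|k IH] // hk.
have [|n1 d1 [x0 [v v0 hv]]] := IH.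
  by move=> i ik; apply: hk; exact: leqW.
have := hk k.+1 (leqnn _); rewrite /=.
case: (iter k _ _) n1 d1 x0 hv => n d /= n1 d1 x0 hv.
rewrite sqrf_eq0 => h0.
have q0 : 0 < n ^+ 2 + M * n * d + N * d ^+ 2.
  by rewrite !addr_gt0 ?mulr_gt0 ?exprn_gt0.
split.
- by rewrite exprn_even_gt0.
- by rewrite !mulr_gt0.
have -> : (n ^+ 2 - N * d ^+ 2) ^+ 2 / (4 * n * d * (n ^+ 2 + M * n * d + N * d ^+ 2))
    = (n / d * (n / d) - N) ^+ 2 / (n / d * (n / d) * (v + v) ^+ 2).
  have -> : (v + v) ^+ 2 = 4 * v ^+ 2 by ring.
  rewrite hv; field.
  by do ?[apply/andP; split]; apply: lt0r_neq0; lra.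
apply: curve_point_add => //.
apply: contra h0 => /eqP <-; apply/eqP; field; lra.
Qed.

Lemma exists_nonroot (F : numFieldType) (l r : F) (p : {poly F}) :
  l < r -> p != 0 -> exists2 t, l < t < r & p.[t] != 0.
Proof.
move=> lr p0.
pose s := [seq l + (r - l) / (k.+2)%:R | k <- iota 0 (size p)].
have rl : 0 < r - l by rewrite subr_gt0.
have us : uniq s.
  rewrite map_inj_uniq ?iota_uniq// => i j /addrI.
  move=> /(mulfI (lt0r_neq0 rl)) /invr_inj /eqP; rewrite eqr_nat => /eqP.
  by case.
have : ~~ all (root p) s.
  apply/negP => hs; have := max_poly_roots p0 hs us.
  by rewrite size_map size_iota ltnn.
move=> /allPn[t /mapP[k _ ->] ht]; exists (l + (r - l) / k.+2%:R) => //.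
rewrite ltrDl divr_gt0//= -ltrBrDl ltr_pdivrMr// ltr_pMr//.
by rewrite ltr1n.
Qed.

(** * Many rational points on the curve attached to a line *)

(* For the form x^2 + D y^2 and the direction U = (1 - D t^2, 2 t), of norm
   1 + D t^2, [ray_dot] and [ray_det] are the inner product of U with (x, y) and
   their determinant divided by sqrt D. *)
Definition ray_dot (T : comNzRingType) (D t x y : T) : T :=
  (1 - D * t ^+ 2) * x + 2 * D * t * y.

Definition ray_det (T : comNzRingType) (D t x y : T) : T :=
  (1 - D * t ^+ 2) * y - 2 * t * x.

Definition curve_M (T : comNzRingType) (D a0 a1 b0 b1 t : T) : T :=
  D * ray_det D t a0 a1 ^+ 2 + D * ray_det D t b0 b1 ^+ 2 +
  ray_dot D t (b0 - a0) (b1 - a1) ^+ 2.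

Definition curve_N (T : comNzRingType) (D a0 a1 b0 b1 t : T) : T :=
  D * ray_det D t a0 a1 ^+ 2 * (D * ray_det D t b0 b1 ^+ 2).

Lemma rmorph_ray_dot (T U : comNzRingType) (f : {rmorphism T -> U}) (D t x y : T) :
  f (ray_dot D t x y) = ray_dot (f D) (f t) (f x) (f y).
Proof.
by rewrite /ray_dot !(rmorph_nat, rmorph1, rmorphM, rmorphXn, rmorphB, rmorphD).
Qed.

Lemma rmorph_ray_det (T U : comNzRingType) (f : {rmorphism T -> U}) (D t x y : T) :
  f (ray_det D t x y) = ray_det (f D) (f t) (f x) (f y).
Proof.
by rewrite /ray_det !(rmorph_nat, rmorph1, rmorphM, rmorphXn, rmorphB, rmorphD).
Qed.

Lemma rmorph_curve_M (T U : comNzRingType) (f : {rmorphism T -> U})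
    (D a0 a1 b0 b1 t : T) :
  f (curve_M D a0 a1 b0 b1 t) = curve_M (f D) (f a0) (f a1) (f b0) (f b1) (f t).
Proof.
rewrite /curve_M -!(rmorphB f) -!rmorph_ray_det -rmorph_ray_dot.
by rewrite -!rmorphXn -!rmorphM -!rmorphD.
Qed.

Lemma rmorph_curve_N (T U : comNzRingType) (f : {rmorphism T -> U})
    (D a0 a1 b0 b1 t : T) :
  f (curve_N D a0 a1 b0 b1 t) = curve_N (f D) (f a0) (f a1) (f b0) (f b1) (f t).
Proof. by rewrite /curve_N -!rmorph_ray_det -!rmorphXn -!rmorphM. Qed.

Lemma exists_ray (R : rcfType) (D x y : R) : 0 < D -> exists t : R, ray_det D t x y = 0.
Proof.
move=> D0; have [->|y0] := eqVneq y 0.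
  by exists 0; rewrite /ray_det; ring.
pose s := Num.sqrt (x ^+ 2 + D * y ^+ 2).
have hs : s ^+ 2 = x ^+ 2 + D * y ^+ 2.
  by rewrite sqr_sqrtr// addr_ge0 ?sqr_ge0// pmulr_rge0 ?sqr_ge0.
exists ((s - x) / (D * y)); rewrite /ray_det.
transitivity ((x ^+ 2 + D * y ^+ 2 - s ^+ 2) / (D * y)).
  by field; rewrite y0 (lt0r_neq0 D0).
by rewrite hs subrr mul0r.
Qed.

(* The starting point is T + 2 c, where T = (0, 0) and c is the difference of two
   of the four points at infinity of the curve
   y1^2 = rho^2 + D p^2, y2^2 = (rho - w)^2 + D q^2 in the space (rho, y1, y2). *)
Lemma many_curve_points_near_pole (F : numFieldType)
    (f : {rmorphism {poly rat} -> F}) (p q w : {poly rat}) (D l r : rat) (J : nat) :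
  0 < D -> p != q -> f p = f q -> f p != 0 -> f w != 0 -> l < r ->
  exists2 t, l < t < r &
    [/\ p.[t] != 0, q.[t] != 0 & exists h : 'I_J.+1 -> rat, injective h /\
      forall i, curve_point (D * p.[t] ^+ 2 + D * q.[t] ^+ 2 + w.[t] ^+ 2)
        (D * p.[t] ^+ 2 * (D * q.[t] ^+ 2)) (h i)].
Proof.
move=> D0 pq fpq fp0 fw0 lr.
pose M := D%:P * p ^+ 2 + D%:P * q ^+ 2 + w ^+ 2.
pose N := D%:P * p ^+ 2 * (D%:P * q ^+ 2).
pose nd k := iter k (dbl M N) ((2 * p * q * w) ^+ 2, (p - q) ^+ 2 * (p + q) ^+ 2).
have fn0 : f ((2 * p * q * w) ^+ 2) != 0.
  by rewrite rmorphXn !rmorphM rmorph_nat -fpq expf_neq0// !mulf_neq0 ?pnatr_eq0.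
have fd0 : f ((p + q) ^+ 2) != 0.
  by rewrite rmorphXn rmorphD -fpq expf_neq0// -mulr2n mulrn_eq0.
have v0 : p - q != 0 by rewrite subr_eq0.
have fv0 : f (p - q) = 0 by rewrite rmorphB fpq subrr.
pose G := (p - q) * (p + q) * \prod_(k < J.+1) (nd k).1 *
  \prod_(i < J.+1) \prod_(j < J.+1 | i != j)
    ((nd i).1 * (nd j).2 - (nd j).1 * (nd i).2).
have G0 : G != 0.
  rewrite /G !mulf_neq0//.
  - by apply: contra fd0 => /eqP ->; rewrite rmorphXn expf_eq0 rmorph0 eqxx.
  - apply/prodf_neq0 => k _.
    have [h _] := iter_dbl_pole M N k fv0 fn0 fd0.
    by apply: contra h => /eqP h; rewrite -/(nd k) h rmorph0.
  - apply/prodf_neq0 => i _; apply/prodf_neq0 => j ij.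
    exact: (iter_dbl_distinct M N v0 fv0 fn0 fd0).
have [t tlr Gt] := exists_nonroot lr G0.
exists t => //.
have : G.[t] != 0 by [].
rewrite /G !hornerM !horner_prod hornerD hornerN hornerD !mulf_eq0 !negb_or.
set P := p.[t]; set Q := q.[t]; set W := w.[t].
move=> /andP[/andP[/andP[PQ1 PQ2]]] /prodf_neq0 hn /prodf_neq0 hd.
have := hn ord0 isT; rewrite /= horner_exp !hornerM -/P -/Q -/W.
rewrite expf_eq0 /= !mulf_eq0 !negb_or => /andP[/andP[/andP[_ P0] Q0] W0].
split=> //.
have D0' : 0 < D * P ^+ 2 by rewrite mulr_gt0// exprn_even_gt0.
have D0'' : 0 < D * Q ^+ 2 by rewrite mulr_gt0// exprn_even_gt0.
set M0 := _ + W ^+ 2; set N0 := _ * (D * Q ^+ 2).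
have M00 : 0 < M0 by rewrite /M0 ltr_wpDr ?sqr_ge0// addr_gt0.
have N00 : 0 < N0 by rewrite mulr_gt0.
pose g : {rmorphism {poly rat} -> rat} := horner_eval t.
have gE u : g u = u.[t] by [].
have gC c : g c%:P = c by rewrite gE hornerC.
have eM : g M = M0 by rewrite !(rmorphM, rmorphXn, rmorphD) gC.
have eN : g N = N0 by rewrite !(rmorphM, rmorphXn, rmorphD) gC.
pose nd0 := ((2 * P * Q * W) ^+ 2, (P - Q) ^+ 2 * (P + Q) ^+ 2).
have end0 k : iter k (dbl M0 N0) nd0 = ((nd k).1.[t], (nd k).2.[t]).
  rewrite -!gE -rmorph_iter_dbl eM eN; congr (iter k _ (_, _)).
    by rewrite !(rmorph_nat, rmorphM, rmorphXn).
  by rewrite !(rmorphM, rmorphXn, rmorphB, rmorphD).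
have n00 : 0 < nd0.1 by rewrite exprn_even_gt0 //= !mulf_neq0.
have d00 : 0 < nd0.2 by rewrite mulr_gt0// exprn_even_gt0.
have hc (k : 'I_J.+1) : [/\ 0 < (iter k (dbl M0 N0) nd0).1,
    0 < (iter k (dbl M0 N0) nd0).2 &
    curve_point M0 N0 ((iter k (dbl M0 N0) nd0).1 / (iter k (dbl M0 N0) nd0).2)].
  apply: curve_point_iter_dbl => //=.
  - apply: (@curve_point_norm _ _ _ _
      (W * (P ^+ 2 + Q ^+ 2) / (P ^+ 2 - Q ^+ 2) + D * (P ^+ 2 - Q ^+ 2) / (2 * W))) => //.
      exact: divr_gt0.
    have PQ3 : P ^+ 2 - Q ^+ 2 != 0 by rewrite subr_sqr mulf_neq0.
    rewrite /M0 /N0; field; rewrite ?P0 ?Q0 ?W0 ?PQ1 ?PQ2 ?PQ3//=.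
  - move=> i ik; rewrite end0.
    by have := hn (Ordinal (leq_ltn_trans ik (ltn_ord k))) isT.
exists (fun k : 'I_J.+1 => (iter k (dbl M0 N0) nd0).1 / (iter k (dbl M0 N0) nd0).2).
split; last by move=> k; have [] := hc k.
move=> i j eij; apply/eqP; apply: contraT => ij.
have [_ di _] := hc i; have [_ dj _] := hc j.
have /prodf_neq0 /(_ j ij) : \prod_(j < J.+1 | i != j)
  ((nd i).1 * (nd j).2 - (nd j).1 * (nd i).2).[t] != 0.
  by have := hd i isT; rewrite horner_prod.
move: eij => /= /eqP; rewrite (eqr_div _ _ (lt0r_neq0 di) (lt0r_neq0 dj)) !end0 /= => /eqP eij.
by rewrite !hornerE eij subrr eqxx.
Qed.

Lemma many_curve_points (R : rcfType) (D a0 a1 b0 b1 l r : rat) (J : nat) :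
  0 < D -> a0 * b1 - a1 * b0 != 0 -> l < r ->
  exists2 t, l < t < r &
    [/\ ray_det D t a0 a1 != 0, ray_det D t b0 b1 != 0 &
      exists f : 'I_J.+1 -> rat, injective f /\
        forall i, curve_point (curve_M D a0 a1 b0 b1 t) (curve_N D a0 a1 b0 b1 t) (f i)].
Proof.
move=> D0 ab lr.
pose p := ray_det D%:P 'X a0%:P a1%:P.
pose q := ray_det D%:P 'X b0%:P b1%:P.
pose w := ray_dot D%:P 'X (b0 - a0)%:P (b1 - a1)%:P.
have rD0 : 0 < ratr D :> R by rewrite ltr0q.
have [t0 ht0] := exists_ray (ratr (a0 - b0)) (ratr (a1 - b1)) rD0.
pose f : {rmorphism {poly rat} -> R} := horner_eval t0 \o map_poly ratr.
have fC c : f c%:P = ratr c by rewrite /f /= map_polyC /horner_eval hornerC.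
have fX : f 'X = t0 by rewrite /f /= map_polyX /horner_eval hornerX.
have fpE : f p = ray_det (ratr D) t0 (ratr a0) (ratr a1).
  by rewrite rmorph_ray_det !fC fX.
have fqE : f q = ray_det (ratr D) t0 (ratr b0) (ratr b1).
  by rewrite rmorph_ray_det !fC fX.
have fwE : f w = ray_dot (ratr D) t0 (ratr (b0 - a0)) (ratr (b1 - a1)).
  by rewrite rmorph_ray_dot !fC fX.
have fpq : f p = f q.
  apply/eqP; rewrite -subr_eq0 fpE fqE -ht0; apply/eqP.
  by rewrite !rmorphB /ray_det /=; ring.
have rab : ratr a0 * ratr b1 - ratr a1 * ratr b0 != 0 :> R.
  by rewrite -!rmorphM -rmorphB fmorph_eq0.
have fp0 : f p != 0.
  apply/eqP => p0; move: fpE fqE; rewrite -fpq p0 /ray_det.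
  set x0 := ratr a0 in rab *; set x1 := ratr a1 in rab *.
  set y0 := ratr b0 in rab *; set y1 := ratr b1 in rab *.
  set d := ratr D in rD0 *.
  move=> e1 e2.
  have : (x0 * y1 - x1 * y0) * (2 * t0) = 0.
    transitivity (- y1 * ((1 - d * t0 ^+ 2) * x1 - 2 * t0 * x0)
      + x1 * ((1 - d * t0 ^+ 2) * y1 - 2 * t0 * y0)); first by ring.
    by rewrite -e1 -e2; ring.
  move/eqP; rewrite mulf_eq0 (negbTE rab) mulf_eq0 pnatr_eq0 /= => /eqP t00.
  have : (x0 * y1 - x1 * y0) * (1 - d * t0 ^+ 2) = 0.
    transitivity (x0 * ((1 - d * t0 ^+ 2) * y1 - 2 * t0 * y0)
      - y0 * ((1 - d * t0 ^+ 2) * x1 - 2 * t0 * x0)); first by ring.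
    by rewrite -e1 -e2; ring.
  move/eqP; rewrite mulf_eq0 (negbTE rab) t00 expr0n mulr0 subr0.
  by rewrite (negbTE (oner_neq0 _)).
have fw0 : f w != 0.
  apply/eqP => w0; move: fwE ht0; rewrite w0 /ray_dot /ray_det !rmorphB /=.
  set x0 := ratr a0 in rab *; set x1 := ratr a1 in rab *.
  set y0 := ratr b0 in rab *; set y1 := ratr b1 in rab *.
  set d := ratr D in rD0 *.
  move=> e1 e2.
  have t20 := sqr_ge0 t0.
  have k0 : 0 < 1 + d * t0 ^+ 2 by nra.
  have h1 : (1 + d * t0 ^+ 2) ^+ 2 * (y0 - x0) = 0.
    transitivity ((1 - d * t0 ^+ 2) * ((1 - d * t0 ^+ 2) * (y0 - x0) + 2 * d * t0 * (y1 - x1))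
      + 2 * d * t0 * ((1 - d * t0 ^+ 2) * (x1 - y1) - 2 * t0 * (x0 - y0))); first by ring.
    by rewrite -e1 e2; ring.
  have h2 : (1 + d * t0 ^+ 2) ^+ 2 * (y1 - x1) = 0.
    transitivity (2 * t0 * ((1 - d * t0 ^+ 2) * (y0 - x0) + 2 * d * t0 * (y1 - x1))
      - (1 - d * t0 ^+ 2) * ((1 - d * t0 ^+ 2) * (x1 - y1) - 2 * t0 * (x0 - y0))); first by ring.
    by rewrite -e1 e2; ring.
  move/eqP: h1; rewrite mulf_eq0 expf_eq0 /= gt_eqF//= subr_eq0 => /eqP h1.
  move/eqP: h2; rewrite mulf_eq0 expf_eq0 /= gt_eqF//= subr_eq0 => /eqP h2.
  by move/eqP: rab; apply; rewrite h1 h2; ring.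
have pq : p != q.
  apply: contra ab => /eqP epq.
  have ev x : ray_det D x a0 a1 = ray_det D x b0 b1.
    have := congr1 (horner^~ x) epq.
    by rewrite /p /q /ray_det !hornerE.
  have := ev 0; have := ev 1; rewrite /ray_det => e1 e0.
  have ea1 : a1 = b1 by lra.
  have ea0 : a0 = b0 by rewrite ea1 in e1; lra.
  by rewrite ea0 ea1 mulrC subrr.
have [t tlr ht] := many_curve_points_near_pole J D0 pq fpq fp0 fw0 lr.
exists t => //=; move: ht.
have -> : p.[t] = ray_det D t a0 a1 by rewrite /p /ray_det !hornerE.
have -> : q.[t] = ray_det D t b0 b1 by rewrite /q /ray_det !hornerE.
have -> : w.[t] = ray_dot D t (b0 - a0) (b1 - a1) by rewrite /w /ray_dot !hornerE.
by [].
Qed.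

(** * From points of the curve to points of the plane *)

(* With h = x (v + w) / (x + Q) and k = x (v - w) / (x + P), the relation
   v^2 = x + P + Q + w^2 + P Q / x gives h = (x + P) / (v - w), k = (x + Q) / (v + w),
   x = h k and h - P / h = k - Q / k + 2 w. So rho := al + (h - P / h) / 2 satisfies
   (rho - al)^2 + P = ((h + P / h) / 2)^2 and
   (rho - al - w)^2 + Q = ((k + Q / k) / 2)^2. *)
Definition ray_abscissa (F : fieldType) (al P Q w x v : F) : F :=
  al + (x * (v + w) / (x + Q) - P * (v - w) / (x + P)) / 2.

Lemma ray_abscissa_sqr1 (F : numFieldType) (al P Q w x v : F) :
  0 <= P -> 0 <= Q -> 0 < x -> v ^+ 2 = x + (P + Q + w ^+ 2) + P * Q / x ->
  (ray_abscissa al P Q w x v - al) ^+ 2 + P =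
  ((x * (v + w) / (x + Q) + P * (v - w) / (x + P)) / 2) ^+ 2.
Proof.
move=> P0 Q0 x0 hv.
have xP : x + P != 0 by rewrite gt_eqF// ltr_wpDr.
have xQ : x + Q != 0 by rewrite gt_eqF// ltr_wpDr.
have x0' : x != 0 by rewrite gt_eqF.
have h : x * (v + w) / (x + Q) * ((v - w) / (x + P)) = 1.
  transitivity (x * (v ^+ 2 - w ^+ 2) / ((x + Q) * (x + P))).
    by field; rewrite xP xQ.
  by rewrite hv; field; rewrite x0' xP xQ.
apply/eqP; rewrite -subr_eq0 /ray_abscissa; apply/eqP.
transitivity (P * (1 - x * (v + w) / (x + Q) * ((v - w) / (x + P)))).
  by field; rewrite xP xQ.
by rewrite h subrr mulr0.
Qed.

Lemma ray_abscissa_sqr2 (F : numFieldType) (al P Q w x v : F) :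
  0 <= P -> 0 <= Q -> 0 < x -> v ^+ 2 = x + (P + Q + w ^+ 2) + P * Q / x ->
  (ray_abscissa al P Q w x v - (al + w)) ^+ 2 + Q =
  ((x * (v - w) / (x + P) + Q * (v + w) / (x + Q)) / 2) ^+ 2.
Proof.
move=> P0 Q0 x0 hv.
have xP : x + P != 0 by rewrite gt_eqF// ltr_wpDr.
have xQ : x + Q != 0 by rewrite gt_eqF// ltr_wpDr.
have -> : ray_abscissa al P Q w x v = ray_abscissa (al + w) Q P (- w) x v.
  by rewrite /ray_abscissa; field; rewrite xP xQ.
rewrite ray_abscissa_sqr1 ?opprK//.
by rewrite hv sqrrN (addrC Q P) (mulrC Q P).
Qed.

(* The point rho U / (1 + D t^2)^2, whose inner product with U is rho. *)
Definition ray_x (F : fieldType) (D t rho : F) : F :=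
  rho * (1 - D * t ^+ 2) / (1 + D * t ^+ 2) ^+ 2.

Definition ray_y (F : fieldType) (D t rho : F) : F :=
  rho * (2 * t) / (1 + D * t ^+ 2) ^+ 2.

Lemma sqr_dist_ray (F : numFieldType) (D t a0 a1 rho : F) :
  1 + D * t ^+ 2 != 0 ->
  (ray_x D t rho - a0) ^+ 2 + D * (ray_y D t rho - a1) ^+ 2 =
  ((rho - ray_dot D t a0 a1) ^+ 2 + D * ray_det D t a0 a1 ^+ 2)
    / (1 + D * t ^+ 2) ^+ 2.
Proof. by move=> r0; rewrite /ray_x /ray_y /ray_dot /ray_det; field. Qed.

Definition curve_abscissa (F : fieldType) (D a0 a1 b0 b1 t x v : F) : F :=
  ray_abscissa (ray_dot D t a0 a1) (D * ray_det D t a0 a1 ^+ 2)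
    (D * ray_det D t b0 b1 ^+ 2) (ray_dot D t (b0 - a0) (b1 - a1)) x v.

Definition rational_square (x : rat) : Prop := exists r : rat, x = r ^+ 2.

Lemma curve_point_rational_squares (D a0 a1 b0 b1 t x v : rat) :
  0 < D -> 0 < x ->
  v ^+ 2 = x + curve_M D a0 a1 b0 b1 t + curve_N D a0 a1 b0 b1 t / x ->
  let rho := curve_abscissa D a0 a1 b0 b1 t x v in
  [/\ rational_square (ray_x D t rho ^+ 2 + D * ray_y D t rho ^+ 2),
      rational_square ((ray_x D t rho - a0) ^+ 2 + D * (ray_y D t rho - a1) ^+ 2) &
      rational_square ((ray_x D t rho - b0) ^+ 2 + D * (ray_y D t rho - b1) ^+ 2)].
Proof.
move=> D0 x0 hv rho.
have r0 : 1 + D * t ^+ 2 != 0.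
  by rewrite gt_eqF// ltr_wpDr// pmulr_rge0// sqr_ge0.
have sq0 y : 0 <= D * y ^+ 2 by rewrite pmulr_rge0// sqr_ge0.
split.
- exists (rho / (1 + D * t ^+ 2)).
  rewrite -[ray_x _ _ _]subr0 -[ray_y _ _ _]subr0 sqr_dist_ray// /ray_dot /ray_det.
  by rewrite expr_div_n; congr (_ / _); ring.
- rewrite sqr_dist_ray// ray_abscissa_sqr1 ?sq0// -expr_div_n.
  by eexists.
- rewrite sqr_dist_ray//.
  have -> : ray_dot D t b0 b1 = ray_dot D t a0 a1 + ray_dot D t (b0 - a0) (b1 - a1).
    by rewrite /ray_dot; ring.
  by rewrite ray_abscissa_sqr2 ?sq0// -expr_div_n; eexists.
Qed.

Lemma ray_abscissa_surj (R : rcfType) (al P Q w rho : R) : 0 < P -> 0 < Q ->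
  exists2 x : R, 0 < x &
    ray_abscissa al P Q w x (Num.sqrt (x + (P + Q + w ^+ 2) + P * Q / x)) = rho.
Proof.
move=> P0 Q0.
pose half (u c : R) := Num.sqrt (u ^+ 2 + c) + u.
have halfP u c : 0 < c -> 0 < half u c /\ half u c - c / half u c = 2 * u.
  move=> c0; have s0 : 0 <= u ^+ 2 + c by rewrite addr_ge0 ?sqr_ge0// ltW.
  have h0 : 0 < half u c.
    rewrite -ltrBlDr sub0r; have [u0|u0] := leP 0 u.
      by apply: (le_lt_trans (y := 0)); rewrite ?oppr_le0// sqrtr_gt0 ltr_wpDl ?sqr_ge0.
    rewrite -(@ltr_pXn2r _ 2) ?nnegrE ?sqrtr_ge0//; last by rewrite oppr_ge0 ltW.
    by rewrite sqr_sqrtr// sqrrN ltrDl.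
  split=> //; apply: (mulfI (lt0r_neq0 h0)).
  have := sqr_sqrtr s0; rewrite mulrBr mulrCA divff ?gt_eqF// /half; nra.
have [h10 h1E] := halfP (rho - al) P P0.
have [h20 h2E] := halfP (rho - (al + w)) Q Q0.
move: (half _ P) (half _ Q) h10 h1E h20 h2E => g h g0 gE h0 hE.
exists (g * h); first exact: mulr_gt0.
have vE : g + Q / h - w = h + P / g + w by lra.
have Ph : 0 < P / g by exact: divr_gt0.
have Qh : 0 < Q / h by exact: divr_gt0.
have -> : g * h + (P + Q + w ^+ 2) + P * Q / (g * h) = (g + Q / h - w) ^+ 2.
  transitivity ((g + Q / h - w + w) * (h + P / g + w - w) + w ^+ 2).
    by field; rewrite !gt_eqF.
  by rewrite -vE; ring.
rewrite sqrtr_sqr ger0_norm; last by lra.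
rewrite /ray_abscissa subrK.
have -> : g + Q / h - w - w = h + P / g by lra.
transitivity (al + (g - P / g) / 2); last by rewrite gE; field.
have gh0 : 0 < g * h by exact: mulr_gt0.
by field; rewrite !lt0r_neq0 ?addr_gt0.
Qed.

Lemma cvg_ray_dot (R : realType) (T : Type) (F : set_system T) {FF : Filter F}
    (D a b t0 : R) (t : T -> R) :
  t z @[z --> F] --> t0 -> ray_dot D (t z) a b @[z --> F] --> ray_dot D t0 a b.
Proof.
move=> ht; apply: cvgD.
  apply: cvgM; last exact: cvg_cst.
  apply: cvgB; first exact: cvg_cst.
  by apply: cvgM; [exact: cvg_cst|exact: cvgM].
by apply: cvgM; last exact: cvg_cst; apply: cvgM; first exact: cvg_cst.
Qed.

Lemma cvg_ray_det (R : realType) (T : Type) (F : set_system T) {FF : Filter F}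
    (D a b t0 : R) (t : T -> R) :
  t z @[z --> F] --> t0 -> ray_det D (t z) a b @[z --> F] --> ray_det D t0 a b.
Proof.
move=> ht; apply: cvgB.
  apply: cvgM; last exact: cvg_cst.
  apply: cvgB; first exact: cvg_cst.
  by apply: cvgM; [exact: cvg_cst|exact: cvgM].
by apply: cvgM; last exact: cvg_cst; apply: cvgM; first exact: cvg_cst.
Qed.

Lemma cvg_ray_abscissa (R : realType) (T : Type) (F : set_system T) {FF : Filter F}
    (al P Q w x v : T -> R) (al0 P0 Q0 w0 x0 v0 : R) :
  0 <= P0 -> 0 <= Q0 -> 0 < x0 ->
  al z @[z --> F] --> al0 -> P z @[z --> F] --> P0 -> Q z @[z --> F] --> Q0 ->
  w z @[z --> F] --> w0 -> x z @[z --> F] --> x0 -> v z @[z --> F] --> v0 ->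
  ray_abscissa (al z) (P z) (Q z) (w z) (x z) (v z) @[z --> F] -->
    ray_abscissa al0 P0 Q0 w0 x0 v0.
Proof.
move=> hP0 hQ0 hx0 hal hP hQ hw hx hv.
have xP : x0 + P0 != 0 by rewrite gt_eqF// ltr_wpDr.
have xQ : x0 + Q0 != 0 by rewrite gt_eqF// ltr_wpDr.
apply: cvgD => //; apply: cvgM; last exact: cvg_cst.
apply: cvgB.
  apply: cvgM; first by apply: cvgM => //; exact: cvgD.
  by apply: cvgV => //; exact: cvgD.
apply: cvgM; first by apply: cvgM => //; exact: cvgB.
by apply: cvgV => //; exact: cvgD.
Qed.

Lemma near_curve_point (R : realType) (d a0 a1 b0 b1 x y e : R) :
  0 < d -> x * a1 - y * a0 != 0 -> x * b1 - y * b0 != 0 -> 0 < e ->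
  let M := curve_M d a0 a1 b0 b1 in let N := curve_N d a0 a1 b0 b1 in
  let rho t X := curve_abscissa d a0 a1 b0 b1 t X (Num.sqrt (X + M t + N t / X)) in
  exists t X c : R, [/\ 0 < X, 0 < c, 0 < N t &
    forall T Y, `|t - T| < c -> `|X - Y| < c ->
      [/\ `|x - ray_x d T (rho T Y)| < e, `|y - ray_y d T (rho T Y)| < e,
        M T < M t + 1 & N t / 2 < N T < N t + 1]].
Proof.
move=> d0 xa yb e0 M N rho.
have [t ht] := exists_ray x y d0.
pose r t := 1 + d * t ^+ 2.
have r0 s : 0 < r s by rewrite ltr_pwDl// pmulr_rge0// sqr_ge0.
pose P t := d * ray_det d t a0 a1 ^+ 2.
pose Q t := d * ray_det d t b0 b1 ^+ 2.
pose w t := ray_dot d t (b0 - a0) (b1 - a1).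
pose v t X := Num.sqrt (X + M t + N t / X).
have r2 : r t ^+ 2 != 0 by rewrite expf_neq0 ?gt_eqF.
have xE : x = ray_x d t (ray_dot d t x y).
  apply: (mulIf r2); rewrite divfK//; apply/eqP; rewrite -subr_eq0; apply/eqP.
  transitivity (- (2 * d * t) * ray_det d t x y); last by rewrite ht mulr0.
  by rewrite /r /ray_dot /ray_det; ring.
have yE : y = ray_y d t (ray_dot d t x y).
  apply: (mulIf r2); rewrite divfK//; apply/eqP; rewrite -subr_eq0; apply/eqP.
  transitivity ((1 - d * t ^+ 2) * ray_det d t x y); last by rewrite ht mulr0.
  by rewrite /r /ray_dot /ray_det; ring.
move: (ray_dot d t x y) xE yE => s xE yE.
have det0 u0 u1 : x * u1 - y * u0 != 0 -> ray_det d t u0 u1 != 0.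
  apply: contra => /eqP h; apply/eqP.
  rewrite xE yE.
  transitivity (s / r t ^+ 2 * ray_det d t u0 u1); last by rewrite h mulr0.
  by rewrite /ray_x /ray_y /ray_det /r; field; exact: (lt0r_neq0 (r0 t)).
have P0 : 0 < P t by rewrite mulr_gt0// exprn_even_gt0//= det0.
have Q0 : 0 < Q t by rewrite mulr_gt0// exprn_even_gt0//= det0.
have [X X0 rhoE] := ray_abscissa_surj (ray_dot d t a0 a1) (w t) s P0 Q0.
pose near2 : set_system (R * R) := filter_prod (nbhs t) (nbhs X).
have ct : z.1 @[z --> near2] --> t by exact: cvg_fst.
have cX : z.2 @[z --> near2] --> X by exact: cvg_snd.
have cal : ray_dot d z.1 a0 a1 @[z --> near2] --> ray_dot d t a0 a1.
  exact: cvg_ray_dot.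
have cw : w z.1 @[z --> near2] --> w t by exact: cvg_ray_dot.
have sqrcvg (h : R * R -> R) (l : R) : h z @[z --> near2] --> l ->
    h z ^+ 2 @[z --> near2] --> l ^+ 2 by move=> hl; exact: cvgM.
have sqrtcvg (h : R * R -> R) (l : R) : h z @[z --> near2] --> l ->
    Num.sqrt (h z) @[z --> near2] --> Num.sqrt l.
  by move=> hl; exact: (cvg_comp _ _ hl (@sqrt_continuous R l)).
have cP : P z.1 @[z --> near2] --> P t.
  by apply: cvgM; [exact: cvg_cst|apply: sqrcvg; exact: cvg_ray_det].
have cQ : Q z.1 @[z --> near2] --> Q t.
  by apply: cvgM; [exact: cvg_cst|apply: sqrcvg; exact: cvg_ray_det].
have cM : M z.1 @[z --> near2] --> M t.
  by apply: cvgD; [exact: cvgD|exact: sqrcvg].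
have cN : N z.1 @[z --> near2] --> N t by exact: cvgM.
have cv : v z.1 z.2 @[z --> near2] --> v t X.
  apply: sqrtcvg; apply: cvgD; first exact: cvgD.
  by apply: cvgM => //; apply: cvgV; rewrite ?gt_eqF.
have crho : rho z.1 z.2 @[z --> near2] --> s.
  rewrite -rhoE; apply: cvg_ray_abscissa => //; exact: ltW.
have cr : (r z.1 ^+ 2)^-1 @[z --> near2] --> (r t ^+ 2)^-1.
  apply: cvgV => //; apply: (sqrcvg); apply: cvgD; first exact: cvg_cst.
  by apply: cvgM; [exact: cvg_cst|exact: sqrcvg].
have cf : ray_x d z.1 (rho z.1 z.2) @[z --> near2] --> x.
  rewrite xE; apply: cvgM => //; apply: cvgM => //.
  by apply: cvgB; [exact: cvg_cst|apply: cvgM; [exact: cvg_cst|exact: sqrcvg]].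
have cg : ray_y d z.1 (rho z.1 z.2) @[z --> near2] --> y.
  by rewrite yE; apply: cvgM => //; apply: cvgM => //; apply: cvgM => //; exact: cvg_cst.
have N0 : 0 < N t by exact: mulr_gt0.
have close (h : R * R -> R) (l c : R) : 0 < c -> h z @[z --> near2] --> l ->
    \forall z \near near2, `|l - h z| < c.
  by move=> c0 /cvgrPdist_lt; apply.
have : \forall z \near near2,
    [/\ `|x - ray_x d z.1 (rho z.1 z.2)| < e, `|y - ray_y d z.1 (rho z.1 z.2)| < e,
      M z.1 < M t + 1 & N t / 2 < N z.1 < N t + 1].
  have N20 : 0 < Num.min 1 (N t / 2) by rewrite lt_min ltr01 divr_gt0.
  have n1 := close _ _ _ e0 cf.
  have n2 := close _ _ _ e0 cg.
  have n3 := close _ _ _ ltr01 cM.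
  have n4 := close _ _ _ N20 cN.
  apply: filterS (filterI (filterI n1 n2) (filterI n3 n4)).
  move=> z [[h1 h2] [h3 h4]]; split=> //; first by move: h3; rewrite ltr_norml; lra.
  by move: h4; rewrite lt_min !ltr_norml; lra.
case=> [[A B]] [/nbhs_ballP[d1 d10 hd1] /nbhs_ballP[d2 d20 hd2]] AB.
exists t, X, (Num.min d1 d2); split=> //; first by rewrite lt_min d10.
move=> T Y; rewrite !lt_min => /andP[hT _] /andP[_ hY].
by apply: (AB (T, Y)); split; [exact: hd1|exact: hd2].
Qed.

Lemma off_two_lines (R : realType) (a0 a1 b0 b1 z0 z1 e : R) :
  a0 * b1 - a1 * b0 != 0 -> 0 < e ->
  exists x y : R, [/\ `|x - z0| < e, `|y - z1| < e,
    x * a1 - y * a0 != 0 & x * b1 - y * b0 != 0].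
Proof.
move=> ab e0.
pose hE := (hornerD, hornerN, hornerM, hornerZ, hornerC, hornerX).
pose k := 1 + `|a0 + b0| + `|a1 + b1|.
have k0 : 0 < k by rewrite /k -addrA ltr_wpDr// addr_ge0.
pose p : {poly R} := (z0%:P + (a0 + b0) *: 'X) * a1%:P - (z1%:P + (a1 + b1) *: 'X) * a0%:P.
pose q : {poly R} := (z0%:P + (a0 + b0) *: 'X) * b1%:P - (z1%:P + (a1 + b1) *: 'X) * b0%:P.
have nz (r : {poly R}) : r.[1] - r.[0] != 0 -> r != 0.
  by apply: contra => /eqP ->; rewrite !horner0 subrr.
have p0 : p != 0.
  apply: nz; have -> : p.[1] - p.[0] = - (a0 * b1 - a1 * b0).
    by rewrite /p !hE; ring.
  by rewrite oppr_eq0.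
have q0 : q != 0.
  apply: nz; have -> : q.[1] - q.[0] = a0 * b1 - a1 * b0; last by [].
  by rewrite /q !hE; ring.
have ek : 0 < e / k by exact: divr_gt0.
have [h /andP[h0 hk]] := exists_nonroot ek (mulf_neq0 p0 q0).
rewrite hornerM mulf_eq0 negb_or => /andP[ph qh].
have small c : `|c| < k -> `|h * c| < e.
  move=> ck; rewrite normrM gtr0_norm//.
  move: hk; rewrite ltr_pdivlMr// => hk; apply: le_lt_trans hk.
  by rewrite ler_pM2l// ltW.
exists (z0 + h * (a0 + b0)), (z1 + h * (a1 + b1)); split.
- rewrite addrAC subrr add0r; apply: small.
  by rewrite /k; have := normr_ge0 (a1 + b1); lra.
- rewrite addrAC subrr add0r; apply: small.
  by rewrite /k; have := normr_ge0 (a0 + b0); lra.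
- by move: ph; rewrite /p !hE (mulrC h) (mulrC h).
- by move: qh; rewrite /q !hE (mulrC h) (mulrC h).
Qed.

Lemma exists_rat_gt (R : realType) (x : R) : exists2 q : rat, 0 < q & x < ratr q.
Proof.
have [q] := rat_in_itvoo (ltr_pwDr ltr01 (lexx `|x|)).
rewrite in_itv /= => /andP[xq _]; exists q; last exact: le_lt_trans (ler_norm x) xq.
by rewrite -(ltr0q R); exact: le_lt_trans xq.
Qed.

Lemma rmorph_curve_point (R : rcfType) (M N x : rat) : curve_point M N x ->
  exists2 v : rat, v ^+ 2 = x + M + N / x &
    ratr v = Num.sqrt (ratr x + ratr M + ratr N / ratr x) :> R.
Proof.
move=> [x0 [v v0 hv]]; exists v => //.
have -> : ratr x + ratr M + ratr N / ratr x = ratr v ^+ 2 :> R.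
  by rewrite -rmorphXn hv !rmorphD fmorph_div.
by rewrite sqrtr_sqr ger0_norm// ler0q ltW.
Qed.

Lemma fmorph_ray_x (F K : fieldType) (f : {rmorphism F -> K}) (D t rho : F) :
  f (ray_x D t rho) = ray_x (f D) (f t) (f rho).
Proof.
by rewrite /ray_x fmorph_div !(rmorphXn, rmorph1, rmorphM, rmorphB, rmorphD).
Qed.

Lemma fmorph_ray_y (F K : fieldType) (f : {rmorphism F -> K}) (D t rho : F) :
  f (ray_y D t rho) = ray_y (f D) (f t) (f rho).
Proof.
by rewrite /ray_y fmorph_div !(rmorph_nat, rmorphXn, rmorph1, rmorphM, rmorphD).
Qed.

Lemma fmorph_ray_abscissa (F K : fieldType) (f : {rmorphism F -> K})
    (al P Q w x v : F) :
  f (ray_abscissa al P Q w x v) = ray_abscissa (f al) (f P) (f Q) (f w) (f x) (f v).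
Proof.
by rewrite /ray_abscissa !(rmorph_nat, fmorphV, rmorphM, rmorphB, rmorphD).
Qed.

Lemma fmorph_curve_abscissa (F K : fieldType) (f : {rmorphism F -> K})
    (D a0 a1 b0 b1 t x v : F) :
  f (curve_abscissa D a0 a1 b0 b1 t x v) =
  curve_abscissa (f D) (f a0) (f a1) (f b0) (f b1) (f t) (f x) (f v).
Proof.
rewrite fmorph_ray_abscissa /curve_abscissa -!(rmorphB f) -!rmorph_ray_det.
by rewrite -!rmorph_ray_dot -!rmorphXn -!rmorphM.
Qed.

Lemma rational_points_dense (R : realType) (D a0 a1 b0 b1 : rat) (z0 z1 e : R) :
  0 < D -> a0 * b1 - a1 * b0 != 0 -> 0 < e ->
  exists x y : rat, [/\ `|ratr x - z0| < e, `|ratr y - z1| < e &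
    [/\ rational_square (x ^+ 2 + D * y ^+ 2),
        rational_square ((x - a0) ^+ 2 + D * (y - a1) ^+ 2) &
        rational_square ((x - b0) ^+ 2 + D * (y - b1) ^+ 2)]].
Proof.
move=> D0 ab e0.
have e20 : 0 < e / 2 by rewrite divr_gt0.
have rab : ratr a0 * ratr b1 - ratr a1 * ratr b0 != 0 :> R.
  by rewrite -!rmorphM -rmorphB fmorph_eq0.
have [x [y [xz yz xa yb]]] := off_two_lines z0 z1 rab e20.
have rD0 : 0 < ratr D :> R by rewrite ltr0q.
have [t [X [c [X0 c0 N0 main]]]] := near_curve_point rD0 xa yb e20.
set M := curve_M _ _ _ _ _ in main; set N := curve_N _ _ _ _ _ in main N0.
have [x1] : exists x1 : rat, ratr x1 \in `]Num.max 0 (X - c), X[.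
  by apply: rat_in_itvoo; rewrite gt_max X0 ltrBlDr ltrDl.
rewrite in_itv /= gt_max => /andP[/andP[x10 x1c] x1X].
have [x2] : exists x2 : rat, ratr x2 \in `]X, X + c[.
  by apply: rat_in_itvoo; rewrite ltrDl.
rewrite in_itv /= => /andP[Xx2 x2c].
have [l] : exists l : rat, ratr l \in `]t - c, t[.
  by apply: rat_in_itvoo; rewrite ltrBlDr ltrDl.
rewrite in_itv /= => /andP[lc lt].
have [u] : exists u : rat, ratr u \in `]t, t + c[.
  by apply: rat_in_itvoo; rewrite ltrDl.
rewrite in_itv /= => /andP[tu uc].
have [n0] : exists n0 : rat, ratr n0 \in `]0, N t / 2[.
  by apply: rat_in_itvoo; rewrite divr_gt0.
rewrite in_itv /= => /andP[n00 n0N].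
have [m1 m10 hm1] := exists_rat_gt (M t + 1).
have [n1 n10 hn1] := exists_rat_gt (N t + 1).
rewrite ltr0q in n00; rewrite ltr0q in x10.
have x12 : 0 < x1 < x2 by rewrite x10 -(ltr_rat R) (lt_trans x1X).
have lu : l < u by rewrite -(ltr_rat R) (lt_trans lt).
have [J hJ] := curve_points_dense x12 m10 n00 n10.
have [T /andP[lT Tu] [p0 q0 [h [h_inj hh]]]] := many_curve_points R J D0 ab lu.
rewrite -(ltr_rat R) in lT; rewrite -(ltr_rat R) in Tu.
have within a b k q : a - k < ratr q -> ratr q < a -> a < ratr b -> ratr b < a + k ->
  forall s : R, ratr q < s -> s < ratr b -> `|a - s| < k.
  by move=> *; rewrite ltr_norml; apply/andP; split; lra.
have Tc : `|t - ratr T| < c by exact: (within _ u _ l).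
have rM : ratr (curve_M D a0 a1 b0 b1 T) = M (ratr T) by rewrite rmorph_curve_M.
have rN : ratr (curve_N D a0 a1 b0 b1 T) = N (ratr T) by rewrite rmorph_curve_N.
have XX : `|X - X| < c by rewrite subrr normr0.
have [_ _ hM /andP[hN1 hN2]] := main _ _ Tc XX.
have hM' : 0 < curve_M D a0 a1 b0 b1 T <= m1.
  rewrite -(ler_rat R) rM (ltW (lt_trans hM hm1)) andbT.
  by rewrite /curve_M ltr_wpDr ?sqr_ge0// addr_gt0// mulr_gt0// exprn_even_gt0.
have hN' : n0 <= curve_N D a0 a1 b0 b1 T <= n1.
  by rewrite -!(ler_rat R) rN (ltW (lt_trans n0N hN1)) (ltW (lt_trans hN2 hn1)).
have [Y cY /andP[x1Y Yx2]] := hJ _ _ h hM' hN' hh h_inj.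
have [Y0 _] := cY.
have [V hV rV] := rmorph_curve_point R cY.
rewrite -(ltr_rat R) in x1Y; rewrite -(ltr_rat R) in Yx2.
have Yc : `|X - ratr Y| < c by exact: (within _ x2 _ x1).
have [hf hg _ _] := main _ _ Tc Yc.
have sq := curve_point_rational_squares D0 Y0 hV.
exists (ray_x D T (curve_abscissa D a0 a1 b0 b1 T Y V)).
exists (ray_y D T (curve_abscissa D a0 a1 b0 b1 T Y V)).
rewrite fmorph_ray_x fmorph_ray_y fmorph_curve_abscissa /= rV rM rN.
have near_trans (k s z : R) : `|s - k| < e / 2 -> `|s - z| < e / 2 -> `|k - z| < e.
  by rewrite !ltr_norml; lra.
by split; [exact: near_trans hf xz|exact: near_trans hg yz|].
Qed.

(** * Rationality of the Gram matrix *)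

Section rational_closure.
Context {R : realType}.
Implicit Types x y : R.

Lemma rational_ratr (q : rat) : rational (ratr q : R).
Proof. by exists q. Qed.

Lemma rationalD x y : rational x -> rational y -> rational (x + y).
Proof. by move=> [p _ <-] [q _ <-]; exists (p + q); rewrite ?rmorphD. Qed.

Lemma rationalB x y : rational x -> rational y -> rational (x - y).
Proof. by move=> [p _ <-] [q _ <-]; exists (p - q); rewrite ?rmorphB. Qed.

Lemma rationalM x y : rational x -> rational y -> rational (x * y).
Proof. by move=> [p _ <-] [q _ <-]; exists (p * q); rewrite ?rmorphM. Qed.

Lemma rationalV x : rational x -> rational x^-1.
Proof. by move=> [p _ <-]; exists p^-1; rewrite ?fmorphV. Qed.

Lemma rationalX x n : rational x -> rational (x ^+ n).
Proof. by move=> [p _ <-]; exists (p ^+ n); rewrite ?rmorphXn. Qed.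

Lemma rational_nat n : rational (n%:R : R).
Proof. by exists n%:R; rewrite ?rmorph_nat. Qed.

End rational_closure.

Lemma rational_relations (R : realType) (n : nat) (w : nat -> R) :
  (exists2 i, (i < n)%N & w i != 0) ->
  exists2 z : nat -> rat, exists2 i, (i < n)%N & z i != 0 &
    forall c : nat -> rat,
      \sum_(i < n) ratr (c i) * w i = 0 -> \sum_(i < n) c i * z i = 0.
Proof.
elim: n => [[]//|n IH [k kn wk]].
have [[c wE]|indep] := pselect (exists c : nat -> rat,
    w n = \sum_(i < n) ratr (c i) * w i).
  have [|z [j jn zj] hz] := IH.
    apply: contrapT => /forall2NP w0.
    have w0' i : (i < n)%N -> w i = 0.
      by move=> ni; have [//|/negP] := w0 i; rewrite negbK => /eqP.
    move: kn wk; rewrite ltnS leq_eqVlt => /orP[/eqP ->|/w0' ->]; rewrite ?eqxx//.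
    by rewrite wE big1 ?eqxx// => i _; rewrite w0' ?mulr0.
  pose s i := if i == n then \sum_(i < n) c i * z i else z i.
  have sz i : (i < n)%N -> s i = z i by move=> ni; rewrite /s ltn_eqF.
  exists s => [|d]; first by exists j; rewrite ?sz// ltnW.
  rewrite !big_ord_recr /= {2}/s eqxx wE => hd.
  under eq_bigr do rewrite sz//.
  transitivity (\sum_(i < n) (d n * c i + d i) * z i).
    by rewrite mulr_sumr -big_split; apply: eq_bigr => m _ /=; ring.
  apply: (hz (fun i => d n * c i + d i)); rewrite -[RHS]hd mulr_sumr -big_split /=.
  by apply: eq_bigr => m _; rewrite rmorphD rmorphM; ring.
exists (fun i => (i == n)%:R) => [|d].
  by exists n; rewrite ?eqxx ?oner_neq0.
rewrite !big_ord_recr /= eqxx mulr1 => hd.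
rewrite big1 => [|i _]; last by rewrite ltn_eqF// mulr0.
have [->|d0] := eqVneq (d n) 0; first by rewrite addr0.
case: indep; exists (fun i => - d i / d n).
have rd0 : ratr (d n) != 0 :> R by rewrite fmorph_eq0.
apply: (mulfI rd0); rewrite mulr_sumr.
transitivity (- \sum_(i < n) ratr (d i) * w i).
  by apply/eqP; rewrite -subr_eq0 opprK addrC; apply/eqP.
rewrite -sumrN; apply: eq_bigr => i _.
by rewrite fmorph_div rmorphN; field.
Qed.

Lemma quadratic_eq0 (R : realFieldType) (c1 c2 c3 c4 c5 c6 : R) :
  (forall u v, c1 * u ^+ 2 + c2 * (u * v) + c3 * v ^+ 2 + c4 * u + c5 * v + c6 = 0) ->
  [/\ c1 = 0, c2 = 0, c3 = 0 & [/\ c4 = 0, c5 = 0 & c6 = 0]].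
Proof.
move=> h; have := h 0 0; have := h 1 0; have := h (-1) 0; have := h 0 1.
by have := h 0 (-1); have := h 1 1; split; try split; lra.
Qed.

Lemma rational_gram (R : realType) (A B C : R) (S : R -> R -> Prop) :
  0 < A -> 0 < B -> A * B - C ^+ 2 != 0 ->
  let X u v := (B * (u + A) ^+ 2 - 2 * C * ((u + A) * (v + B)) + A * (v + B) ^+ 2)
    / (4 * (A * B - C ^+ 2)) in
  (forall u v, S u v -> [/\ rational u, rational v & rational (X u v)]) ->
  (forall c0 c1 c2 c3 c4 c5 c6 : R,
    let G u v := c0 * X u v + c1 * u ^+ 2 + c2 * (u * v) + c3 * v ^+ 2 +
      c4 * u + c5 * v + c6 in
    (forall u v, S u v -> G u v = 0) -> forall u v, G u v = 0) ->
  [/\ rational A, rational B & rational C].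
Proof.
move=> A0 B0; set E := A * B - C ^+ 2 => E0 X Srat Sdense.
have X_E u v : 4 * E * X u v =
    B * (u + A) ^+ 2 - 2 * C * ((u + A) * (v + B)) + A * (v + B) ^+ 2.
  by rewrite mulrC divfK// mulf_neq0// pnatr_eq0.
pose w := [:: 4 * E; - B; 2 * C; - A; - (2 * B * (A - C)); - (2 * A * (B - C));
  - (A ^+ 2 * B - 2 * C * A * B + A * B ^+ 2)].
have [|z [k k7 zk] hz] := @rational_relations R 7 (fun i => w`_i).
  by exists 0%N => //=; rewrite mulf_neq0// pnatr_eq0.
pose q j : R := ratr (z j).
have Gq u v : q 0%N * X u v + q 1%N * u ^+ 2 + q 2%N * (u * v) + q 3%N * v ^+ 2 +
    q 4%N * u + q 5%N * v + q 6%N = 0.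
  apply: Sdense => {}u {}v /Srat [[u' _ uE] [v' _ vE] [x _ xE]].
  pose m := [:: x; u' ^+ 2; u' * v'; v' ^+ 2; u'; v'; 1].
  have := hz (fun i => m`_i); rewrite !big_ord_recr !big_ord0 /=.
  rewrite xE !rmorphXn !rmorphM uE vE rmorph1 /q -xE -uE -vE => hz0.
  rewrite -!rmorphXn -!rmorphM -!rmorphD -[RHS](rmorph0 (ratr : {rmorphism rat -> R})).
  congr ratr; rewrite -[RHS]hz0; first by ring.
  have := X_E u v; rewrite -xE -uE -vE => h.
  rewrite /E in h *; lra.
have coef u v : (4 * E * q 1%N + q 0%N * B) * u ^+ 2 +
    (4 * E * q 2%N - 2 * q 0%N * C) * (u * v) +
    (4 * E * q 3%N + q 0%N * A) * v ^+ 2 +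
    (4 * E * q 4%N + q 0%N * (2 * B * (A - C))) * u +
    (4 * E * q 5%N + q 0%N * (2 * A * (B - C))) * v +
    (4 * E * q 6%N + q 0%N * (A ^+ 2 * B - 2 * C * A * B + A * B ^+ 2)) = 0.
  have h : 4 * E * (q 0%N * X u v + q 1%N * u ^+ 2 + q 2%N * (u * v) +
      q 3%N * v ^+ 2 + q 4%N * u + q 5%N * v + q 6%N) = 0 by rewrite Gq mulr0.
  have := X_E u v; move: (X u v) (E) h => x e h1 h2.
  transitivity (4 * e * (q 0%N * x + q 1%N * u ^+ 2 + q 2%N * (u * v) +
      q 3%N * v ^+ 2 + q 4%N * u + q 5%N * v + q 6%N) - q 0%N * (4 * e * x -
      (B * (u + A) ^+ 2 - 2 * C * ((u + A) * (v + B)) + A * (v + B) ^+ 2))).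
    by ring.
  by rewrite h1 h2 subrr mulr0 subrr.
have [e1 e2 e3 [e4 e5 e6]] := quadratic_eq0 coef.
have E40 : 4 * E != 0 by rewrite mulf_neq0// pnatr_eq0.
have z0 : q 0%N != 0.
  apply/eqP => q0; rewrite q0 in e1 e2 e3 e4 e5 e6.
  have qk : 4 * E * q k = 0.
    by case: k k7 {zk} => [|[|[|[|[|[|[|//]]]]]]] _; rewrite ?q0; lra.
  move/eqP: qk; rewrite mulf_eq0 (negbTE E40) /= => /eqP qk.
  move/eqP: zk; case; apply: (fmorph_inj (ratr : {rmorphism rat -> R})).
  by rewrite rmorph0; exact: qk.
pose r j := - q j / q 0%N.
have rr j : rational (r j).
  by rewrite /r /q -rmorphN -fmorph_div; exact: rational_ratr.
have qr j : q j = - r j * q 0%N by rewrite /r; field.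
have eB : B = 4 * E * r 1%N.
  by apply: (mulfI z0); move: e1; rewrite (qr 1%N); lra.
have eC : - C = 2 * E * r 2%N.
  by apply: (mulfI z0); move: e2; rewrite (qr 2%N); lra.
have eA : A = 4 * E * r 3%N.
  by apply: (mulfI z0); move: e3; rewrite (qr 3%N); lra.
have e4' : 2 * B * (A - C) = 4 * E * r 4%N.
  by apply: (mulfI z0); move: e4; rewrite (qr 4%N); lra.
have e5' : 2 * A * (B - C) = 4 * E * r 5%N.
  by apply: (mulfI z0); move: e5; rewrite (qr 5%N); lra.
have r1 : r 1%N != 0 by apply/eqP => r0; move: B0; rewrite eB r0 mulr0 ltxx.
have r3 : r 3%N != 0 by apply/eqP => r0; move: A0; rewrite eA r0 mulr0 ltxx.
have AC : 2 * r 1%N * (A - C) = r 4%N.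
  by apply: (mulfI E40); rewrite -e4' eB; ring.
have BC : 2 * r 3%N * (B - C) = r 5%N.
  by apply: (mulfI E40); rewrite -e5' eA; ring.
have rAC : rational (A - C).
  have -> : A - C = r 4%N / (2%:R * r 1%N) by rewrite -AC; field.
  by apply: rationalM => //; apply: rationalV; apply: rationalM => //; exact: rational_nat.
have rBC : rational (B - C).
  have -> : B - C = r 5%N / (2%:R * r 3%N) by rewrite -BC; field.
  by apply: rationalM => //; apply: rationalV; apply: rationalM => //; exact: rational_nat.
suff rE : rational E.
  have rnE n j : rational (n%:R * E * r j).
    by apply: rationalM => //; apply: rationalM => //; exact: rational_nat.
  have rA : rational A by rewrite eA; exact: rnE.
  split=> //; first by rewrite eB; exact: rnE.
  by rewrite -[C](subKr A); exact: rationalB.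
have sol j D : rational D -> D != 0 -> D = 2 * E * (2 * r j + r 2%N) -> rational E.
  move=> rD D0 De.
  have s0 : 2 * r j + r 2%N != 0.
    by apply: contra D0 => /eqP s0; rewrite De s0 mulr0.
  have -> : E = D / (2%:R * (2%:R * r j + r 2%N)) by rewrite De; field.
  have r2 := @rational_nat R 2.
  apply: rationalM => //; apply: rationalV; apply: rationalM => //.
  by apply: rationalD => //; exact: rationalM.
have [AC0|AC0] := eqVneq (A - C) 0; last by apply: (sol 3%N _ rAC AC0); lra.
have [BC0|BC0] := eqVneq (B - C) 0; last by apply: (sol 1%N _ rBC BC0); lra.
move/eqP: E0; case; rewrite /E.
have -> : A = C by lra.
have -> : B = C by lra.
by rewrite expr2 subrr.
Qed.

(** * Geometry of the plane *)

Section plane.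
Context {R : realType}.
Implicit Types A B C Q : 'rV[R]_2.

Definition dot A B : R := A 0 0 * B 0 0 + A 0 1 * B 0 1.
Definition cross A B : R := A 0 0 * B 0 1 - A 0 1 * B 0 0.

Lemma enorm_sqr A : enorm A ^+ 2 = dot A A.
Proof.
rewrite /enorm sqr_sqrtr; last by apply: sumr_ge0 => i _; exact: sqr_ge0.
have l1 : lift ord0 ord0 = 1 :> 'I_2 by exact: val_inj.
by rewrite !big_ord_recl big_ord0 addr0 /dot -!expr2 l1.
Qed.

Lemma rowP2 A B : A 0 0 = B 0 0 -> A 0 1 = B 0 1 -> A = B.
Proof.
move=> h0 h1; apply/rowP => -[[|[|//]] p].
  by rewrite (_ : Ordinal p = 0)//; exact: val_inj.
by rewrite (_ : Ordinal p = 1)//; exact: val_inj.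
Qed.

Lemma rational_enorm A (r : R) : rational r -> dot A A = r ^+ 2 -> rational (enorm A).
Proof.
move=> [q _ <-]; rewrite -enorm_sqr => h; exists `|q| => //.
apply/eqP; rewrite -(@eqrXn2 _ 2)// ?ler0q ?sqrtr_ge0//.
by rewrite h -!rmorphXn real_normK// num_real.
Qed.

Lemma dot_gt0 A : A != 0 -> 0 < dot A A.
Proof.
move=> A0; rewrite ltNge; apply: contra A0; rewrite /dot -!expr2 => h.
have := sqr_ge0 (A 0 0); have := sqr_ge0 (A 0 1) => h0 h1.
have /eqP : A 0 0 ^+ 2 = 0 by lra.
have /eqP : A 0 1 ^+ 2 = 0 by lra.
rewrite !sqrf_eq0 => /eqP e1 /eqP e0.
by apply/eqP/rowP2; rewrite mxE.
Qed.

Lemma nonaligned_cross A B C : ~ aligned A B C -> cross (A - C) (B - C) != 0.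
Proof.
apply: contra_notN => /eqP ab.
have witness u s t : u != 0 -> A - C = s *: u -> B - C = t *: u -> aligned A B C.
  move=> u0 eA eB; exists C, u; split=> // M.
  rewrite !inE => /or3P[] /eqP ->.
  - by exists s; rewrite -eA addrC subrK.
  - by exists t; rewrite -eB addrC subrK.
  - by exists 0; rewrite scale0r addr0.
have [a0|a0] := eqVneq (A - C) 0.
  have [b0|b0] := eqVneq (B - C) 0.
    apply: (witness (const_mx 1) 0 0); rewrite ?scale0r//.
    by apply/eqP => /rowP/(_ 0)/eqP; rewrite !mxE oner_eq0.
  by apply: (witness (B - C) 0 1); rewrite ?scale0r ?scale1r.
apply: (witness (A - C) 1 (dot (A - C) (B - C) / dot (A - C) (A - C))) => //.
  by rewrite scale1r.
have d0 := lt0r_neq0 (dot_gt0 a0).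
move: (A - C) (B - C) ab d0 => {a0 witness} a b; rewrite /cross /dot => ab d0.
apply: rowP2; rewrite !mxE; apply: (mulfI d0); rewrite mulrA [_ * (_ / _)]mulrC divfK//.
  transitivity ((a 0 0 * b 0 0 + a 0 1 * b 0 1) * a 0 0
     - a 0 1 * (a 0 0 * b 0 1 - a 0 1 * b 0 0)); first by ring.
  by rewrite ab mulr0 subr0.
transitivity ((a 0 0 * b 0 0 + a 0 1 * b 0 1) * a 0 1
   + a 0 0 * (a 0 0 * b 0 1 - a 0 1 * b 0 0)); first by ring.
by rewrite ab mulr0 addr0.
Qed.

Lemma gram_sqr A B Q : cross A B ^+ 2 * dot Q Q =
  dot B B * dot Q A ^+ 2 - 2 * dot A B * (dot Q A * dot Q B) + dot A A * dot Q B ^+ 2.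
Proof. by rewrite /cross /dot; ring. Qed.

Lemma cross_sqr A B : cross A B ^+ 2 = dot A A * dot B B - dot A B ^+ 2.
Proof. by rewrite /cross /dot; ring. Qed.

Lemma cross_decomp A B Q : cross A B != 0 ->
  Q = ((dot B B * dot Q A - dot A B * dot Q B) / cross A B ^+ 2) *: A +
      ((dot A A * dot Q B - dot A B * dot Q A) / cross A B ^+ 2) *: B.
Proof. by move=> ab; apply: rowP2; rewrite !mxE /dot; rewrite /cross in ab *; field. Qed.

Lemma exists_dots A B x y : cross A B != 0 -> exists Q, dot Q A = x /\ dot Q B = y.
Proof.
move=> ab; exists (((dot B B * x - dot A B * y) / cross A B ^+ 2) *: A +
  ((dot A A * y - dot A B * x) / cross A B ^+ 2) *: B).
by split; rewrite /dot !mxE; rewrite /cross in ab *; field.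
Qed.

Lemma dense_eq0 (T : topologicalType) (S : set T) (h : T -> R) :
  dense S -> continuous h -> (forall x, S x -> h x = 0) -> forall x, h x = 0.
Proof.
move=> dS ch hS x; apply/eqP; apply: contraT => hx.
have [||y [hy Sy]] := dS (h @^-1` [set~ 0]).
- by exists x; exact/eqP.
- by apply: open_comp => [y _|]; [exact: ch|rewrite openC; apply: accessible_closed_set1; exact/hausdorff_accessible/norm_hausdorff].
by case: hy; exact: hS.
Qed.

Lemma continuous_add (T : topologicalType) (f g : T -> R) :
  continuous f -> continuous g -> continuous (fun x => f x + g x).
Proof. by move=> cf cg x; exact: (cvgD (cf x) (cg x)). Qed.

Lemma continuous_sub (T : topologicalType) (f g : T -> R) :
  continuous f -> continuous g -> continuous (fun x => f x - g x).
Proof. by move=> cf cg x; exact: (cvgB (cf x) (cg x)). Qed.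

Lemma continuous_mul (T : topologicalType) (f g : T -> R) :
  continuous f -> continuous g -> continuous (fun x => f x * g x).
Proof. by move=> cf cg x; exact: (cvgM (cf x) (cg x)). Qed.

Lemma continuous_subr_coord A (j : 'I_2) : continuous (fun Q => (Q - A) 0 j).
Proof.
rewrite (_ : (fun Q => _) = fun Q => Q 0 j - A 0 j); last first.
  by apply/funext => P; rewrite !mxE.
by apply: continuous_sub; [exact: coord_continuous|exact: cst_continuous].
Qed.

Lemma continuous_dot A B : continuous (fun Q => dot (Q - A) B).
Proof.
by apply: continuous_add; apply: continuous_mul;
  solve [exact: cst_continuous|exact: continuous_subr_coord].
Qed.

Lemma continuous_dot2 A : continuous (fun Q => dot (Q - A) (Q - A)).
Proof.
by apply: continuous_add; apply: continuous_mul; exact: continuous_subr_coord.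
Qed.

Definition rational_distances A B C Q : Prop :=
  [/\ rational (edist Q A), rational (edist Q B) & rational (edist Q C)].

Lemma edistE A B : edist A B ^+ 2 = dot (A - B) (A - B).
Proof. by rewrite enorm_sqr /dot !mxE; ring. Qed.

Lemma dense_rational_gram A B C : cross (A - C) (B - C) != 0 ->
  dense [set Q | rational_distances A B C Q] ->
  [/\ rational (dot (A - C) (A - C)), rational (dot (B - C) (B - C)) &
    rational (dot (A - C) (B - C))].
Proof.
set a := A - C; set b := B - C => ab dS.
have a0 : a != 0 by apply: contra ab => /eqP ->; rewrite /cross !mxE !mul0r subrr.
have b0 : b != 0 by apply: contra ab => /eqP ->; rewrite /cross !mxE !mulr0 subrr.
have E0 : dot a a * dot b b - dot a b ^+ 2 != 0 by rewrite -cross_sqr expf_neq0.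
pose u Q := 2 * dot (Q - C) a - dot a a.
pose v Q := 2 * dot (Q - C) b - dot b b.
have XE Q : dot (Q - C) (Q - C) =
    (dot b b * (u Q + dot a a) ^+ 2
     - 2 * dot a b * ((u Q + dot a a) * (v Q + dot b b))
     + dot a a * (v Q + dot b b) ^+ 2) / (4 * (dot a a * dot b b - dot a b ^+ 2)).
  rewrite /u /v !subrK -cross_sqr.
  have ab2 : cross a b ^+ 2 != 0 by rewrite expf_neq0.
  transitivity (4 * (cross a b ^+ 2 * dot (Q - C) (Q - C)) / (4 * cross a b ^+ 2)).
    by field.
  by rewrite gram_sqr; congr (_ / _); ring.
apply: (@rational_gram _ _ _ _ (fun x y => exists2 Q, rational_distances A B C Q & x = u Q /\ y = v Q)) => //.
- exact: dot_gt0.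
- exact: dot_gt0.
- move=> _ _ [Q [rA rB rC] [-> ->]]; rewrite -XE.
  have rXC : rational (dot (Q - C) (Q - C)) by rewrite -edistE; exact: rationalX.
  split=> //.
    have -> : u Q = edist Q C ^+ 2 - edist Q A ^+ 2.
      by rewrite !edistE /u /a /dot !mxE; ring.
    by apply: rationalB; exact: rationalX.
  have -> : v Q = edist Q C ^+ 2 - edist Q B ^+ 2.
    by rewrite !edistE /v /b /dot !mxE; ring.
  by apply: rationalB; exact: rationalX.
- move=> c0 c1 c2 c3 c4 c5 c6 G hG x y.
  pose g Q := c0 * dot (Q - C) (Q - C) + c1 * u Q ^+ 2 + c2 * (u Q * v Q) +
    c3 * v Q ^+ 2 + c4 * u Q + c5 * v Q + c6.
  have gE Q : g Q = G (u Q) (v Q) by rewrite /g XE.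
  have cu : continuous u.
    apply: continuous_sub; last exact: cst_continuous.
    by apply: continuous_mul; [exact: cst_continuous|exact: continuous_dot].
  have cv : continuous v.
    apply: continuous_sub; last exact: cst_continuous.
    by apply: continuous_mul; [exact: cst_continuous|exact: continuous_dot].
  have cg : continuous g.
    apply: continuous_add; last exact: cst_continuous.
    do 5 ?[apply: continuous_add];
      (apply: continuous_mul; first exact: cst_continuous) => //.
    + exact: continuous_dot2.
    + exact: continuous_mul.
    + exact: continuous_mul.
    + exact: continuous_mul.
  have g0 := dense_eq0 dS cg.
  have [Q [Qa Qb]] := exists_dots ((x + dot a a) / 2) ((y + dot b b) / 2) ab.
  have -> : x = u (Q + C) by rewrite /u addrK Qa; field.
  have -> : y = v (Q + C) by rewrite /v addrK Qb; field.
  rewrite -gE; apply: g0 => P hP; rewrite gE; apply: hG.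
  by exists P.
Qed.

Lemma rational_dot_dists A B C :
  (forall P Q, P \in [:: A; B; C] -> Q \in [:: A; B; C] ->
    rational (edist P Q ^+ 2)) <->
  [/\ rational (dot (A - C) (A - C)), rational (dot (B - C) (B - C)) &
    rational (dot (A - C) (B - C))].
Proof.
have r2 := @rational_nat R 2.
split=> [h|[rA rB rC]].
  have rA : rational (dot (A - C) (A - C)) by rewrite -edistE; apply: h; rewrite !inE eqxx ?orbT.
  have rB : rational (dot (B - C) (B - C)) by rewrite -edistE; apply: h; rewrite !inE eqxx ?orbT.
  have rAB : rational (dot (A - B) (A - B)) by rewrite -edistE; apply: h; rewrite !inE eqxx ?orbT.
  split=> //; have -> : dot (A - C) (B - C) =
      (dot (A - C) (A - C) + dot (B - C) (B - C) - dot (A - B) (A - B)) / 2%:R.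
    by rewrite /dot !mxE; field.
  by apply: rationalM; [apply: rationalB => //; exact: rationalD|exact: rationalV].
have rAB : rational (dot (A - B) (A - B)).
  have -> : dot (A - B) (A - B) =
      dot (A - C) (A - C) + dot (B - C) (B - C) - 2%:R * dot (A - C) (B - C).
    by rewrite /dot !mxE; ring.
  by apply: rationalB; [exact: rationalD|exact: rationalM].
have sym P Q : dot (P - Q) (P - Q) = dot (Q - P) (Q - P) by rewrite /dot !mxE; ring.
have r0 P : rational (dot (P - P) (P - P)).
  by rewrite subrr /dot !mxE !mul0r addr0; exact: (@rational_nat R 0).
move=> P Q; rewrite !inE edistE.
by move=> /or3P[] /eqP -> /or3P[] /eqP ->; rewrite // sym.
Qed.

Lemma quadratic_formE A B C x y :
  enorm (x *: (C - A) + y *: (C - B)) ^+ 2 =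
  dot (A - C) (A - C) * x ^+ 2 + (2%:R * dot (A - C) (B - C)) * (x * y) +
    dot (B - C) (B - C) * y ^+ 2.
Proof. by rewrite enorm_sqr /dot !mxE; ring. Qed.

Lemma rational_coefficientsE A B C :
  rational_coefficients (fun x y => enorm (x *: (C - A) + y *: (C - B)) ^+ 2) <->
  [/\ rational (dot (A - C) (A - C)), rational (dot (B - C) (B - C)) &
    rational (dot (A - C) (B - C))].
Proof.
split=> [[a [b [c h]]]|[[a _ ha] [c _ hc] [b _ hb]]]; last first.
  exists a, (2%:R * b), c => x y.
  by rewrite quadratic_formE -ha -hb -hc -(rmorph_nat (ratr : {rmorphism rat -> R})) -rmorphM.
have rr := @rational_ratr R.
have hA := h 1 0; have hB := h 0 1; have hC := h 1 1.
rewrite !quadratic_formE in hA hB hC.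
have eA : dot (A - C) (A - C) = ratr a by lra.
have eB : dot (B - C) (B - C) = ratr c by lra.
have eC : dot (A - C) (B - C) = ratr (b / 2%:R) by rewrite fmorph_div rmorph_nat; lra.
by rewrite eA eB eC.
Qed.

Lemma represents_square_of_point A B C Q :
  cross (A - C) (B - C) != 0 ->
  [/\ rational (dot (A - C) (A - C)), rational (dot (B - C) (B - C)) &
    rational (dot (A - C) (B - C))] ->
  rational_distances A B C Q ->
  represents_square (fun x y => enorm (x *: (C - A) + y *: (C - B)) ^+ 2).
Proof.
move=> ab [rA rB rC] [qA qB qC].
have [QC|QC] := eqVneq Q C.
  exists 1, 0; split; first by apply/eqP => -[/eqP]; rewrite oner_eq0.
  move: qA; rewrite QC => -[r _ hr]; exists r.
  rewrite hr edistE rmorph1 rmorph0 scale1r scale0r addr0 enorm_sqr.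
  by rewrite /dot !mxE; ring.
have r2 := @rational_nat R 2.
have rQA : rational (dot (Q - C) (A - C)).
  have -> : dot (Q - C) (A - C) =
      (edist Q C ^+ 2 + dot (A - C) (A - C) - edist Q A ^+ 2) / 2%:R.
    by rewrite !edistE /dot !mxE; field.
  apply: rationalM; last exact: rationalV.
  by apply: rationalB; [apply: rationalD => //|]; exact: rationalX.
have rQB : rational (dot (Q - C) (B - C)).
  have -> : dot (Q - C) (B - C) =
      (edist Q C ^+ 2 + dot (B - C) (B - C) - edist Q B ^+ 2) / 2%:R.
    by rewrite !edistE /dot !mxE; field.
  apply: rationalM; last exact: rationalV.
  by apply: rationalB; [apply: rationalD => //|]; exact: rationalX.
have QE := cross_decomp (Q - C) ab.
have rcross : rational (cross (A - C) (B - C) ^+ 2).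
  by rewrite cross_sqr; apply: rationalB; [exact: rationalM|exact: rationalX].
set x := (X in X *: _ + _) in QE; set y := (X in _ + X *: _) in QE.
have [x' _ ex] : rational x.
  apply: rationalM; last exact: rationalV.
  by apply: rationalB; exact: rationalM.
have [y' _ ey] : rational y.
  apply: rationalM; last exact: rationalV.
  by apply: rationalB; exact: rationalM.
exists x', y'; split.
  apply: contra QC => /eqP[x0 y0].
  by rewrite -subr_eq0 QE -ex -ey x0 y0 rmorph0 !scale0r addr0.
case: qC => r _ hr; exists r; rewrite hr ex ey edistE enorm_sqr.
have -> : x *: (C - A) + y *: (C - B) = - (Q - C).
  by rewrite QE opprD -!scalerN !opprB.
by rewrite /dot !mxE; ring.
Qed.

End plane.

Section rotation.
Context {R : realType}.
Implicit Types A B C Q : 'rV[R]_2.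

Definition perp A : 'rV[R]_2 := \row_j (if j == 0 then - A 0 1 else A 0 0).

Lemma perp_coords A : (perp A 0 0 = - A 0 1) * (perp A 0 1 = A 0 0).
Proof. by rewrite !mxE. Qed.

Lemma unit_coord_le1 A (j : 'I_2) : dot A A = 1 -> `|A 0 j| <= 1.
Proof.
rewrite /dot -!expr2 => u1; rewrite -(@expr_le1 _ 2)// real_normK ?num_real//.
have h0 := sqr_ge0 (A 0 0); have h1 := sqr_ge0 (A 0 1).
by case: j => [[|[|//]] p]; [rewrite (_ : Ordinal p = 0)|rewrite (_ : Ordinal p = 1)];
  try exact: val_inj; lra.
Qed.

Lemma dot_perp A s t : dot (s *: A + t *: perp A) (s *: A + t *: perp A) =
  (s ^+ 2 + t ^+ 2) * dot A A.
Proof. by rewrite /dot !mxE /=; ring. Qed.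

Lemma orthonormal_decomp A Q : dot A A = 1 -> Q = dot A Q *: A + cross A Q *: perp A.
Proof.
move=> u1; apply: rowP2; rewrite !mxE /= /dot /cross.
  by rewrite -[LHS]mul1r -u1 /dot; ring.
by rewrite -[LHS]mul1r -u1 /dot; ring.
Qed.

Lemma rational_axis A B (u : 'rV[R]_2) : cross A B != 0 -> dot u u = 1 ->
  rational (dot A A) -> rational (dot B B) -> rational (dot A B) ->
  rational (dot u A) -> rational (dot u B) ->
  exists l : R, [/\ l != 0, rational (l ^+ 2),
    rational (l * cross u A) & rational (l * cross u B)].
Proof.
move=> ab u1 rA rB rAB ruA ruB.
have cc P Q : cross u P * cross u Q = dot P Q - dot u P * dot u Q.
  by rewrite -[dot P Q]mul1r -u1 /cross /dot; ring.
have rcc P Q : rational (dot u P) -> rational (dot u Q) -> rational (dot P Q) ->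
    rational (cross u P * cross u Q).
  by move=> rP rQ rPQ; rewrite cc; apply: rationalB => //; exact: rationalM.
have [a0|a0] := eqVneq (cross u A) 0; last first.
  by exists (cross u A); split=> //; rewrite ?expr2; exact: rcc.
exists (cross u B); split.
- apply: contra ab => /eqP b0; apply/eqP; rewrite -[LHS]mul1r -u1.
  transitivity (dot u A * cross u B - cross u A * dot u B).
    by rewrite /cross /dot; ring.
  by rewrite a0 b0 mulr0 mul0r subrr.
- by rewrite expr2; exact: rcc.
- by rewrite a0 mulr0; exact: (@rational_nat R 0).
- exact: rcc.
Qed.

Lemma rational_unit A B (x y r : rat) : cross A B != 0 -> (x, y) != (0, 0) ->
  rational (dot A A) -> rational (dot B B) -> rational (dot A B) ->
  let v := ratr x *: A + ratr y *: B in
  dot v v = ratr r ^+ 2 ->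
  exists u : 'rV[R]_2, [/\ dot u u = 1, rational (dot u A) & rational (dot u B)].
Proof.
move=> ab xy rA rB rAB v vr.
have rx := @rational_ratr R.
have v0 : v != 0.
  apply: contra xy => /eqP v0.
  have crA : ratr x * cross A B = 0.
    transitivity (cross v B); last by rewrite v0 /cross !mxE !mul0r subrr.
    by rewrite /cross !mxE; ring.
  have crB : ratr y * cross A B = 0.
    transitivity (cross A v); last by rewrite v0 /cross !mxE !mulr0 subrr.
    by rewrite /cross !mxE; ring.
  move/eqP: crA; rewrite mulf_eq0 (negbTE ab) orbF fmorph_eq0 => /eqP ->.
  by move/eqP: crB; rewrite mulf_eq0 (negbTE ab) orbF fmorph_eq0 => /eqP ->.
have r0 : ratr r != 0 :> R.
  by apply/eqP => r0; have := dot_gt0 v0; rewrite vr r0 expr0n ltxx.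
exists ((ratr r)^-1 *: v); split.
- transitivity (dot v v / ratr r ^+ 2); first by rewrite /dot !mxE; field.
  by rewrite vr divff// expf_neq0.
- have -> : dot ((ratr r)^-1 *: v) A =
      (ratr r)^-1 * (ratr x * dot A A + ratr y * dot A B).
    by rewrite /dot !mxE; ring.
  apply: rationalM; first exact: rationalV.
  by apply: rationalD; exact: rationalM.
have -> : dot ((ratr r)^-1 *: v) B =
    (ratr r)^-1 * (ratr x * dot A B + ratr y * dot B B).
  by rewrite /dot !mxE; ring.
apply: rationalM; first exact: rationalV.
by apply: rationalD; exact: rationalM.
Qed.

Lemma dense_rational_distances A B C (u : 'rV[R]_2) :
  cross (A - C) (B - C) != 0 ->
  [/\ rational (dot (A - C) (A - C)), rational (dot (B - C) (B - C)) &
    rational (dot (A - C) (B - C))] ->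
  dot u u = 1 -> rational (dot u (A - C)) -> rational (dot u (B - C)) ->
  dense [set Q | rational_distances A B C Q].
Proof.
move=> ab [rA rB rAB] u1 ruA ruB O [z Oz] openO.
have [l [l0 rl rla rlb]] := rational_axis ab u1 rA rB rAB ruA ruB.
have [e e0 ball_e] : exists2 e : R, 0 < e & ball z e `<=` O.
  by have /nbhs_ballP[e e0 ?] := open_nbhs_nbhs (conj openO Oz); exists e.
have [D _ eD] := rl.
have D0 : 0 < D by rewrite -(ltr0q R) eD exprn_even_gt0.
have coords P : rational (dot u (P - C)) -> rational (l * cross u (P - C)) ->
  exists p : rat * rat, P = C + (ratr p.1 *: u + (ratr p.2 * l) *: perp u).
  move=> [p0 _ e0'] [p1 _ e1]; exists (p0, p1 / D) => /=.
  have -> : ratr (p1 / D) = ratr p1 / ratr D :> R by rewrite fmorph_div.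
  have -> : ratr p1 / ratr D * l = cross u (P - C) by rewrite e1 eD; field.
  by rewrite e0' -orthonormal_decomp// addrC subrK.
have [[a0 a1] /= aE] := coords A ruA rla.
have [[b0 b1] /= bE] := coords B ruB rlb.
have det0 : a0 * b1 - a1 * b0 != 0.
  apply: contra ab => /eqP det0.
  have -> : cross (A - C) (B - C) = l * ratr (a0 * b1 - a1 * b0) * dot u u.
    rewrite aE bE ![C + _]addrC !addrK rmorphB !rmorphM /cross /dot !mxE /=.
    ring.
  by rewrite det0 rmorph0 mulr0 mul0r.
have l10 : 0 < 1 + `|l| by rewrite ltr_pwDl.
have d0 : 0 < e / (1 + `|l|) by exact: divr_gt0.
have [x [y [hx hy [[rC hC] [rA' hA] [rB' hB]]]]] :=
  rational_points_dense (dot u (z - C)) (cross u (z - C) / l) D0 det0 d0.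
pose Q := C + (ratr x *: u + (ratr y * l) *: perp u).
have dist P p q r : P = C + (ratr p *: u + (ratr q * l) *: perp u) ->
    (x - p) ^+ 2 + D * (y - q) ^+ 2 = r ^+ 2 -> rational (edist Q P).
  move=> PE hr; apply: (@rational_enorm _ _ (ratr r)); first exact: rational_ratr.
  have -> : P - Q = ratr (p - x) *: u + (ratr (q - y) * l) *: perp u.
    by rewrite PE /Q; apply: rowP2; rewrite !mxE !rmorphB; ring.
  rewrite dot_perp u1 -[ratr r ^+ 2]rmorphXn -hr.
  transitivity (ratr (p - x) ^+ 2 + ratr (q - y) ^+ 2 * ratr D : R).
    by rewrite eD; ring.
  by rewrite -!rmorphXn -rmorphM -rmorphD; congr ratr; ring.
exists Q; split; last first.
  split; [exact: dist aE hA|exact: dist bE hB|apply: (dist C 0 0 rC)].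
    by rewrite rmorph0 mul0r !scale0r !addr0.
  by rewrite !subr0.
apply: ball_e; split=> // i j; rewrite (ord1 i) /ball /=.
have zE : z = C + (dot u (z - C) *: u + cross u (z - C) *: perp u).
  by rewrite -orthonormal_decomp// addrC subrK.
have -> : z 0 j - Q 0 j = (dot u (z - C) - ratr x) * u 0 j
    + (cross u (z - C) / l - ratr y) * (l * perp u 0 j).
  by rewrite {1}zE /Q !mxE; field.
have pu1 : dot (perp u) (perp u) = 1 by rewrite -u1 /dot !mxE /=; ring.
apply: (le_lt_trans (ler_normD _ _)); rewrite !normrM.
have -> : e = e / (1 + `|l|) * 1 + e / (1 + `|l|) * (`|l| * 1).
  by rewrite -mulrDr !mulr1 divfK ?gt_eqF.
apply: ltr_leD.
  rewrite distrC.
  apply: (@le_lt_trans _ _ (`|ratr x - dot u (z - C)| * 1)).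
    by rewrite ler_wpM2l// unit_coord_le1.
  by rewrite ltr_pM2r.
rewrite distrC; apply: ler_pM => //; first by rewrite mulr_ge0.
  exact: ltW.
by rewrite ler_wpM2l// unit_coord_le1.
Qed.

End rotation.

Theorem theorem1p1 (R : realType) (P1 P2 P3 : 'rV[R]_2)
    (nonaligned : ~ aligned P1 P2 P3) :
  let rational_distances (Q : 'rV[R]_2) : Prop :=
    [/\ rational (edist Q P1), rational (edist Q P2) & rational (edist Q P3)] in
  let q (x y : R) : R :=
    enorm (x *: (P3 - P1) + y *: (P3 - P2)) ^+ 2 in
  [<-> (* (i) *) dense [set Q | rational_distances Q];
       (* (ii) *) rational_coefficients q /\ represents_square q;
       (* (iii) *)
       (forall A B, A \in [:: P1; P2; P3] -> B \in [:: P1; P2; P3] ->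
          rational (edist A B ^+ 2)) /\
       (exists Q, rational_distances Q)].
Proof.
move=> rd q.
have ab := nonaligned_cross nonaligned.
have dense_point : dense [set Q | rd Q] -> exists Q, rd Q.
  move=> dS; have [|Q [_ rQ]] := dS setT _ openT; last by exists Q.
  by exists P1.
have square_dense : rational_coefficients q /\ represents_square q ->
    dense [set Q | rd Q].
  move=> [/rational_coefficientsE [rA rB rAB] [x [y [xy [r hr]]]]].
  have [|u [u1 uA uB]] := @rational_unit _ _ _ x y r ab xy rA rB rAB.
    by rewrite -hr /q enorm_sqr /dot !mxE; ring.
  exact: dense_rational_distances ab _ u1 uA uB.
have dense_square : dense [set Q | rd Q] ->
    rational_coefficients q /\ represents_square q.
  move=> dS; have gram := dense_rational_gram ab dS.
  have [Q rQ] := dense_point dS.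
  split; first exact/rational_coefficientsE.
  exact: represents_square_of_point ab gram rQ.
tfae=> //.
- move=> h; split; last exact/dense_point/square_dense.
  by apply/rational_dot_dists/rational_coefficientsE; case: h.
- move=> [/rational_dot_dists gram [Q rQ]]; apply: square_dense; split.
    exact/rational_coefficientsE.
  exact: represents_square_of_point ab gram rQ.
Qed.
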